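(* Let $n>2$ and let $1\le r\le k\le n$ be integers. Let $A(n,k,r)$ be the $(n,k,r)$-arrangement graph, and let $P(S_n)$ and $Q(S_k)$ be the groups of permutations of its vertex set $[n]^{(k)}$ induced respectively by permuting values and by permuting coordinates. Then $$Aut(A(n,k,r))\cong \begin{cases} P(S_n)\times Q(S_k) & \text{if } r=k<n,\\ [P(S_n)\times Q(S_n)]\rtimes Z_2 & \text{if } r=k=n,\\ [P(S_n)\times Q(S_n)]\rtimes Z_2 & \text{if } r=2,\ k=n. \end{cases}$$ Here $Z_2=\langle h\rangle$, where $h$ is the permutation of $[n]^{(n)}$ given by $[s_1,s_2,\dots,s_n]^h=[x_1,x_2,\dots,x_n]$ with $x_j=i$ if $s_i=j$, for $j=1,2,\dots,n$.
   Context: $[n]=\{1,2,\dots,n\}$, $S_n$ is the symmetric group on $[n]$, and $[n]^{(k)}$ is the set of all ordered $k$-tuples $[s_1,\dots,s_k]$ of distinct elements of $[n]$. For $1\le r\le k\le n$, the $(n,k,r)$-arrangement graph $A(n,k,r)$ is the undirected graph with vertex set $[n]^{(k)}$ in which $[s_1,\dots,s_k]$ and $[t_1,\dots,t_k]$ are adjacent if and only if $|\{i : s_i\ne t_i,\ 1\le i\le k\}|=r$. $Aut(\Gamma)$ denotes the full automorphism group of a graph $\Gamma$. Permutations act on the right, written as exponents. For $g\in S_n$, the permutation $P(g)$ of $[n]^{(k)}$ is defined by $[s_1,\dots,s_k]^{P(g)}=[s_1^g,\dots,s_k^g]$; for $h\in S_k$, the permutation $Q(h)$ of $[n]^{(k)}$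 is defined by $[s_1,\dots,s_k]^{Q(h)}=[s_{1^{h^{-1}}},\dots,s_{k^{h^{-1}}}]$. $P(S_n)=\{P(g):g\in S_n\}$ and $Q(S_k)=\{Q(h):h\in S_k\}$. The products $P(S_n)\times Q(S_k)$ and $[P(S_n)\times Q(S_n)]\rtimes\langle h\rangle$ are understood as internal (semi)direct products inside the symmetric group on $[n]^{(k)}$. *)

(* Defs.v *)
From mathcomp Require Import all_boot all_fingroup.

Set Implicit Arguments.
Unset Strict Implicit.
Unset Printing Implicit Defensive.

Local Open Scope group_scope.

Section GraphAutomorphisms.

Variables (T : finType) (e : rel T).

Definition graph_aut : {set {perm T}} :=
  [set f : {perm T} | [forall x, forall y, e (f x) (f y) == e x y]].

Lemma graph_autP (f : {perm T}) :
  reflect (forall x y, e (f x) (f y) = e x y) (f \in graph_aut).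
Proof.
rewrite inE; apply: (iffP forallP) => [ef x y | ef x].
  by apply/eqP; move/forallP: (ef x); apply.
by apply/forallP => y; rewrite ef.
Qed.

Fact graph_aut_group_set : group_set graph_aut.
Proof.
apply/group_setP; split=> [|f g /graph_autP ef /graph_autP eg].
  by apply/graph_autP => x y; rewrite !perm1.
by apply/graph_autP => x y; rewrite !permM eg ef.
Qed.
Canonical graph_aut_group := Group graph_aut_group_set.

End GraphAutomorphisms.

(* The set [n]^(k); the elements 1, ..., n of [n] are encoded as 0, ..., n-1. *)
Notation arrangement n k := {t : k.-tuple 'I_n | uniq t}.

Section Arrangements.

Variables n k : nat.
Implicit Types s t : arrangement n k.

(* Irreflexive only for r > 0. *)
Definition arr_adj (r : nat) : rel (arrangement n k) :=
  fun s t => #|[set i : 'I_k | tnth (val s) i != tnth (val t) i]| == r.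

Lemma arr_adj_sym r : symmetric (arr_adj r).
Proof.
by move=> s t; congr (_ == _); apply: eq_card => i; rewrite !inE eq_sym.
Qed.

Lemma arr_adj_irr r : 0 < r -> irreflexive (arr_adj r).
Proof.
move=> r_gt0 s; rewrite /arr_adj (_ : [set _ | _] = set0).
  by rewrite cards0 eq_sym eqn0Ngt r_gt0.
by apply/setP=> i; rewrite !inE eqxx.
Qed.

Lemma arr_inj s : injective (tnth (val s)).
Proof. exact/tuple_uniqP/(valP s). Qed.

Lemma arr_ext s t : (forall i, tnth (val s) i = tnth (val t) i) -> s = t.
Proof. by move=> st; apply/val_inj/eq_from_tnth. Qed.

Fact arr_of_subproof (f : 'I_k -> 'I_n) :
  injective f -> uniq [tuple f i | i < k].
Proof.
by move=> f_inj; apply/tuple_uniqP => i j; rewrite !tnth_mktuple => /f_inj.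
Qed.

Definition arr_of (f : 'I_k -> 'I_n) (f_inj : injective f) : arrangement n k :=
  exist _ [tuple f i | i < k] (arr_of_subproof f_inj).

Lemma tnth_arr_of f (f_inj : injective f) i : tnth (val (arr_of f_inj)) i = f i.
Proof. exact: tnth_mktuple. Qed.

Definition arrP_fun (g : 'S_n) s : arrangement n k :=
  arr_of (inj_comp (@perm_inj _ g) (@arr_inj s)).

Fact arrP_inj g : injective (arrP_fun g).
Proof.
move=> s t st; apply: arr_ext => i; apply: (@perm_inj _ g).
by move/(congr1 (fun u : arrangement n k => tnth (val u) i)): st; rewrite !tnth_arr_of.
Qed.

Definition arrP g : {perm arrangement n k} := perm (@arrP_inj g).

Definition arrQ_fun (h : 'S_k) s : arrangement n k :=
  arr_of (inj_comp (@arr_inj s) (@perm_inj _ h^-1)).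

Fact arrQ_inj h : injective (arrQ_fun h).
Proof.
move=> s t st; apply: arr_ext => i.
move/(congr1 (fun u : arrangement n k => tnth (val u) (h i))): st.
by rewrite !tnth_arr_of /= permK.
Qed.

Definition arrQ h : {perm arrangement n k} := perm (@arrQ_inj h).

Definition arrP_Sym : {set {perm arrangement n k}} := [set arrP g | g : 'S_n].
Definition arrQ_Sym : {set {perm arrangement n k}} := [set arrQ h | h : 'S_k].

Lemma arrPE g s i : tnth (val (arrP g s)) i = g (tnth (val s) i).
Proof. by rewrite permE tnth_arr_of. Qed.

Lemma arrQE h s i : tnth (val (arrQ h s)) i = tnth (val s) (h^-1 i).
Proof. by rewrite permE tnth_arr_of. Qed.

End Arrangements.

Section Inversion.

Variable n : nat.
Implicit Types s t : arrangement n n.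

Definition arrV_fun s : arrangement n n :=
  arr_of (can_inj (f_invF (@arr_inj _ _ s))).

Fact arrV_inj : injective arrV_fun.
Proof.
move=> s t st; apply: arr_ext => i.
apply: (can_inj (f_invF (@arr_inj _ _ s))).
have /esym := congr1 (fun u : arrangement n n => tnth (val u) (tnth (val t) i)) st.
by rewrite !tnth_arr_of !invF_f.
Qed.

Definition arrV : {perm arrangement n n} := perm arrV_inj.

Lemma arrVP s i j : tnth (val s) i = j -> tnth (val (arrV s)) j = i.
Proof. by move<-; rewrite permE tnth_arr_of invF_f. Qed.

End Inversion.

(* Main.v *)
Require Import Defs.
From mathcomp Require Import all_boot all_fingroup.
From mathcomp Require Import cyclic.

(* Call a pair (position, value) a cell, so that an arrangement is a set of [k]
   cells.  An automorphism [f] is shown to act on cells: for every [s] there is a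
   bijection [pi s] of the positions such that, whenever [s] and [t] share the cell
   at [i], [f s] and [f t] share a cell at [pi s i = pi t i].  The induced action on
   the cells preserves the lines of the [k] x [n] grid, hence permutes the rows and
   the columns, or possibly exchanges them if [k = n].
   For [r = 2], [k = n], the graph is the Cayley graph of S_n for the
   transpositions, and the cells of [s] are the stars of the line graph of K_n
   formed by the neighbours of [s].  For [r = k < n], the vertices differing from
   [s] in one position are those having the most common neighbours with [s];
   comparing [s] with such vertices detects the [x] that meet [s] in one cell.  For
   [r = k = n], the vertices differing from [s] by a transposition are the
   nonadjacent ones having the most common neighbours with [s], which reduces this
   case to [r = 2]. *)

Set Implicit Arguments.
Unset Strict Implicit.
Unset Printing Implicit Defensive.

Local Open Scope group_scope.

Local Notation "s .[ i ]" := (tnth (val s) i).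

(** * Coordinate and value permutations *)

Section Arrangements.

Variables n k : nat.
Implicit Types (s t x y : arrangement n k) (i j l : 'I_k) (a b : 'I_n).

Lemma arr_adj_fullP s t :
  reflect (forall i, s.[i] != t.[i]) (arr_adj k s t).
Proof.
rewrite /arr_adj; set A := [set _ | _].
have -> : (#|A| == k) = (A == setT).
  rewrite eqEcard subsetT cardsT card_ord eqn_leq.
  by have := max_card [in A]; rewrite card_ord => ->.
apply: (iffP eqP) => [AT i | ne].
  by have := in_setT i; rewrite -AT inE.
by apply/setP => i; rewrite !inE ne.
Qed.

Lemma arr_adj1P s t :
  reflect (exists2 i, s.[i] != t.[i] & forall j, j != i -> s.[j] = t.[j])
          (arr_adj 1 s t).
Proof.
apply: (iffP cards1P) => [[i def] | [i ne eq]].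
  exists i => [|j ji]; first by move/setP: def => /(_ i); rewrite !inE eqxx.
  by apply/eqP; move/setP: def => /(_ j); rewrite !inE (negPf ji) => /negbFE.
exists i; apply/setP => j; rewrite !inE.
by have [-> | /eq->] := eqVneq j i; rewrite ?ne ?eqxx.
Qed.

Lemma arrPM : {morph @arrP n k : g h / g * h}.
Proof.
by move=> g h; apply/permP => s; apply: arr_ext => i; rewrite permM !arrPE permM.
Qed.

Lemma arrQM : {morph @arrQ n k : g h / g * h}.
Proof.
move=> g h; apply/permP => s; apply: arr_ext => i.
by rewrite permM !arrQE invMg permM.
Qed.

Lemma arrP1 : arrP k (1 : 'S_n) = 1.
Proof. by apply/permP => s; apply: arr_ext => i; rewrite arrPE !perm1. Qed.

Lemma arrQ1 : arrQ n (1 : 'S_k) = 1.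
Proof. by apply/permP => s; apply: arr_ext => i; rewrite arrQE invg1 !perm1. Qed.

Lemma arrPQ_comm (g : 'S_n) (h : 'S_k) : commute (arrP k g) (arrQ n h).
Proof.
apply/permP => s; apply: arr_ext => i.
by rewrite !permM !(arrPE, arrQE).
Qed.

Lemma arrP_Sym_group_set : group_set (arrP_Sym n k).
Proof.
apply/group_setP; split=> [|_ _ /imsetP[g _ ->] /imsetP[h _ ->]].
  by apply/imsetP; exists 1; rewrite ?arrP1.
by rewrite -arrPM imset_f.
Qed.
Canonical arrP_Sym_group := Group arrP_Sym_group_set.

Lemma arrQ_Sym_group_set : group_set (arrQ_Sym n k).
Proof.
apply/group_setP; split=> [|_ _ /imsetP[g _ ->] /imsetP[h _ ->]].
  by apply/imsetP; exists 1; rewrite ?arrQ1.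
by rewrite -arrQM imset_f.
Qed.
Canonical arrQ_Sym_group := Group arrQ_Sym_group_set.

Lemma arrP_aut r (g : 'S_n) : arrP k g \in graph_aut (@arr_adj n k r).
Proof.
apply/graph_autP => s t; congr (_ == _); apply: eq_card => i.
by rewrite !inE !arrPE (inj_eq perm_inj).
Qed.

Lemma arrQ_aut r (h : 'S_k) : arrQ n h \in graph_aut (@arr_adj n k r).
Proof.
apply/graph_autP => s t; congr (_ == _).
rewrite -[RHS](card_imset _ (@perm_inj _ h)); apply: eq_card => i.
by rewrite !inE !arrQE -{3}[i](permKV h) mem_imset ?inE //; apply: perm_inj.
Qed.

Lemma arr_cell_ex (le_kn : k <= n) i a : exists s, s.[i] = a.
Proof.
have widen_inj : injective (widen_ord le_kn).
  by move=> j l /(congr1 val) jl; apply: val_inj.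
pose s0 := arr_of widen_inj.
by exists (arrP k (tperm s0.[i] a) s0); rewrite arrPE tpermL.
Qed.

Lemma arr_cell2_ex (le_kn : k <= n) i j a b :
  i != j -> a != b -> exists2 s : arrangement n k, s.[i] = a & s.[j] = b.
Proof.
move=> ij ab; have [s si] := arr_cell_ex le_kn i a.
exists (arrP k (tperm s.[j] b) s); rewrite arrPE ?tpermL // -si.
by rewrite tpermD ?si 1?eq_sym // -si (inj_eq (@arr_inj _ _ s)).
Qed.

(** Induction on the number of positions where [s] and [t] differ: exchanging the values [s.[j]] and
    [t.[j]] in [s] repairs position [j], spoils no position of agreement and keeps the cell at
    [i]. *)
Lemma arr_cell_conn (T : Type) (c : arrangement n k -> T) i a :
    (forall s u v, s.[i] = a -> u \in codom (tnth (val s)) ->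
       u != v -> u != a -> v != a -> c (arrP k (tperm u v) s) = c s) ->
  forall s t, s.[i] = a -> t.[i] = a -> c s = c t.
Proof.
move=> step s t; have [m] := ubnP #|[set j | s.[j] != t.[j]]|.
elim: m s => // m IHm s lt_m si ti.
have [/eqP | [j st_j]] := set_0Vmem [set j | s.[j] != t.[j]].
  rewrite -subset0 => /subsetP eq_st; congr c; apply: arr_ext => j.
  by apply/eqP/negbNE/negP => st_j; have := eq_st j; rewrite !inE => /(_ st_j).
have ne_ij : i != j.
  by apply: contraTneq st_j => <-; rewrite inE si ti eqxx.
have sja : s.[j] != a by rewrite -si (inj_eq (@arr_inj _ _ s)) eq_sym.
have tja : t.[j] != a by rewrite -ti (inj_eq (@arr_inj _ _ t)) eq_sym.
rewrite inE in st_j; rewrite -(step s s.[j] t.[j]) ?codom_f //.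
apply: IHm => //; last by rewrite arrPE si tpermD.
rewrite -ltnS; apply: leq_trans lt_m; rewrite ltnS.
apply/proper_card/properP; split.
  apply/subsetP => l; rewrite !inE; apply: contraNneq => st_l.
  have lj : l != j by apply: contraNneq st_j => <-; apply/eqP.
  rewrite arrPE tpermD -?st_l //.
    by rewrite (inj_eq (@arr_inj _ _ s)) eq_sym.
  by rewrite st_l (inj_eq (@arr_inj _ _ t)) eq_sym.
by exists j; rewrite !inE ?st_j // arrPE tpermL eqxx.
Qed.

End Arrangements.

(** * Automorphisms acting on cells *)

Lemma prod_ext (A B : Type) (c d : A * B) : c.1 = d.1 -> c.2 = d.2 -> c = d.
Proof. by case: c d => [a b] [a' b'] /= -> ->. Qed.

(** * Collinearity-preserving maps of a grid *)

Section RookGraph.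

Variables (k n : nat) (phi : 'I_k * 'I_n -> 'I_k * 'I_n).

(** Rows stand for positions and columns for values: this is adjacency or equality in the rook
    graph. *)
Definition collinear (c d : 'I_k * 'I_n) := (c.1 == d.1) || (c.2 == d.2).

Hypothesis phi_inj : injective phi.
Hypothesis phi_col : forall c d, collinear c d -> collinear (phi c) (phi d).

(** The cells of an image row are pairwise collinear. If two of them lie in different rows they
    share a column, and any cell collinear with both is in that column. *)
Lemma rook_row i :
  (forall a b, (phi (i, a)).1 = (phi (i, b)).1) \/
  (forall a b, (phi (i, a)).2 = (phi (i, b)).2).
Proof.
have col a b : collinear (phi (i, a)) (phi (i, b)).
  by apply: phi_col; rewrite /collinear eqxx.
have [/forallP eq1 | /forallPn[a /forallPn[b ne1]]] :=
  boolP [forall a, forall b, (phi (i, a)).1 == (phi (i, b)).1].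
  by left=> a b; apply/eqP; move/forallP: (eq1 a); apply.
right; suff eq2 d : (phi (i, d)).2 = (phi (i, a)).2 by move=> d e; rewrite !eq2.
have /eqP eq_ab : (phi (i, a)).2 == (phi (i, b)).2.
  by have := col a b; rewrite /collinear (negPf ne1).
have /orP[/eqP eq_da | /eqP //] := col d a.
by have := col d b; rewrite /collinear eq_da (negPf ne1) eq_ab => /eqP.
Qed.

(** Each row fills its image row, so distinct rows go to distinct rows. Two cells of one column in
    different rows then have collinear images in different rows, hence in one column. *)
Lemma rook_horizontal (i0 : 'I_k) (a0 : 'I_n) :
    (forall i a b, (phi (i, a)).1 = (phi (i, b)).1) ->
  exists p : 'S_k, exists q : 'S_n, forall i a, phi (i, a) = (p i, q a).
Proof.
move=> hor; pose p i := (phi (i, a0)).1; pose q a := (phi (i0, a)).2.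
have row_inj i : injective (fun a => (phi (i, a)).2).
  move=> a b eq_ab; have [] // : (i, a) = (i, b).
  by apply: phi_inj; apply: prod_ext; rewrite ?(hor i a b) ?eq_ab.
have p_inj : injective p.
  move=> i j pij; have /codomP[a eq_a] := injF_onto (@row_inj i) (phi (j, a0)).2.
  have [] // : (i, a) = (j, a0).
  by apply: phi_inj; apply: prod_ext; rewrite ?(hor i a a0) -?eq_a.
exists (perm p_inj), (perm (@row_inj i0)) => i a; rewrite !permE.
apply: prod_ext; first exact: hor.
have [-> // | ii0] := eqVneq i i0.
have /phi_col : collinear (i, a) (i0, a) by rewrite /collinear eqxx orbT.
rewrite /collinear (hor i a a0) (hor i0 a a0) (inj_eq p_inj) (negPf ii0).
by move/eqP.
Qed.

End RookGraph.

Section SquareRookGraph.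

Variables (n : nat) (phi : 'I_n * 'I_n -> 'I_n * 'I_n).
Hypothesis phi_inj : injective phi.
Hypothesis phi_col : forall c d, collinear c d -> collinear (phi c) (phi d).

(** Image lines have full length here. If one row went to a column and another to a row, their
    images would cross, against injectivity. *)
Lemma rook_square :
  (forall i a b, (phi (i, a)).1 = (phi (i, b)).1) \/
  (forall i a b, (phi (i, a)).2 = (phi (i, b)).2).
Proof.
have [/forallP hor | /forallPn[i not_hor]] :=
  boolP [forall i, forall a, forall b, (phi (i, a)).1 == (phi (i, b)).1].
  left=> i a b; apply/eqP.
  by move/forallP: (hor i) => /(_ a) /forallP; apply.
have ver_i : forall a b, (phi (i, a)).2 = (phi (i, b)).2.
  have [hor_i | //] := rook_row phi_col i.
  case/negP: not_hor; apply/forallP=> a; apply/forallP=> b.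
  by rewrite (hor_i a b).
right=> j; have [hor_j | //] := rook_row phi_col j => a b.
have inj1 : injective (fun d => (phi (i, d)).1).
  move=> d e eq_de; have [] // : (i, d) = (i, e).
  by apply: phi_inj; apply: prod_ext; rewrite ?(ver_i d e) ?eq_de.
have inj2 : injective (fun d => (phi (j, d)).2).
  move=> d e eq_de; have [] // : (j, d) = (j, e).
  by apply: phi_inj; apply: prod_ext; rewrite ?(hor_j d e) ?eq_de.
have /codomP[d eq_d] := injF_onto inj1 (phi (j, a)).1.
have /codomP[e eq_e] := injF_onto inj2 (phi (i, d)).2.
have [ij _] : (i, d) = (j, e).
  apply: phi_inj; apply: prod_ext => //.
  by rewrite -eq_d (hor_j a e).
by rewrite -ij; apply: ver_i.
Qed.

End SquareRookGraph.

Lemma collinear_swap n (c d : 'I_n * 'I_n) :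
  collinear (c.2, c.1) (d.2, d.1) = collinear c d.
Proof. by rewrite /collinear orbC. Qed.

(** * From bijections of the positions to cell maps *)

Section CellMaps.

Variables n k : nat.
Hypotheses (le_kn : k <= n) (k_gt0 : 0 < k).
Variables (f : {perm arrangement n k}) (pi : arrangement n k -> 'I_k -> 'I_k).
Hypothesis pi_inj : forall s, injective (pi s).
Hypothesis pi_coh : forall s t i, s.[i] = t.[i] ->
  pi s i = pi t i /\ (f s).[pi s i] = (f t).[pi t i].

(** [phi] records [pi s i] and the value of [f s] there, for any [s] through the cell. It is onto
    since every cell lies on some [f s], hence injective. Non-collinear images lie on a common
    [f s], so they come from two distinct cells of [s], which are not collinear. *)
Lemma cell_map_ex : exists phi : 'I_k * 'I_n -> 'I_k * 'I_n,
  [/\ injective phi,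
      forall c d, collinear c d -> collinear (phi c) (phi d)
    & forall s i, (f s).[(phi (i, s.[i])).1] = (phi (i, s.[i])).2].
Proof.
have [phi phiP] : exists phi : 'I_k * 'I_n -> 'I_k * 'I_n, forall c s,
    s.[c.1] = c.2 -> phi c = (pi s c.1, (f s).[pi s c.1]).
  apply: (@fin_all_exists _ _ (fun c d => forall s : arrangement n k,
    s.[c.1] = c.2 -> d = (pi s c.1, (f s).[pi s c.1]))) => -[i a].
  have [s si] := arr_cell_ex le_kn i a.
  exists (pi s i, (f s).[pi s i]) => t /= ti.
  by have [|-> ->] := @pi_coh s t i; rewrite ?si.
have phi_onto (s : arrangement n k) (c : 'I_k * 'I_n) :
    (f s).[c.1] = c.2 -> exists i, phi (i, s.[i]) = c.
  case: c => j b /= <-; have /codomP[i ->] := injF_onto (@pi_inj s) j.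
  by exists i; rewrite (phiP _ s).
have phi_inj : injective phi.
  have [psi psiK] : exists psi, forall c, phi (psi c) = c.
    apply: (@fin_all_exists _ _ (fun c d => phi d = c)) => -[j b].
    have [t tj] := arr_cell_ex le_kn j b.
    have [|i <-] := phi_onto (f^-1 t) (j, b); first by rewrite permKV.
    by exists (i, (f^-1 t).[i]).
  exact/can_inj/canF_sym/psiK.
exists phi; split=> // [c d | s i]; last by rewrite (phiP _ s).
apply: contraTT; rewrite /collinear negb_or => /andP[ne1 ne2].
have [t tc td] := arr_cell2_ex le_kn ne1 ne2.
have [|i /phi_inj ci] := phi_onto (f^-1 t) (phi c); first by rewrite permKV.
have [|j /phi_inj dj] := phi_onto (f^-1 t) (phi d); first by rewrite permKV.
rewrite -ci -dj /= (inj_eq (@arr_inj _ _ _)) orbb.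
by apply: contraNneq ne1 => ij; rewrite -ci -dj ij.
Qed.

Lemma cell_perm_PQ (g : {perm arrangement n k}) (p : 'S_k) (q : 'S_n) :
  (forall s i, (g s).[p i] = q s.[i]) -> g \in arrP_Sym n k * arrQ_Sym n k.
Proof.
move=> gE; apply/mulsgP; exists (arrP k q) (arrQ n p); rewrite ?imset_f //.
apply/permP=> s; apply: arr_ext => i.
by rewrite permM arrQE arrPE -gE permKV.
Qed.

(** A row has [n] cells and a column only [k < n], so no row is sent into a column. *)
Lemma cell_aut_lt : k < n -> f \in arrP_Sym n k * arrQ_Sym n k.
Proof.
move=> lt_kn; have [phi [phi_inj phi_col fE]] := cell_map_ex.
pose i0 := Ordinal k_gt0; pose a0 := Ordinal (leq_trans k_gt0 le_kn).
have [|p [q phiE]] := rook_horizontal phi_inj phi_col i0 a0.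
  move=> i; have [// | ver] := rook_row phi_col i.
  have inj1 : injective (fun d => (phi (i, d)).1).
    move=> d e eq_de; have [] // : (i, d) = (i, e).
    by apply: phi_inj; apply: prod_ext; rewrite ?(ver d e) ?eq_de.
  by have := leq_card _ inj1; rewrite !card_ord leqNgt lt_kn.
by apply: (@cell_perm_PQ _ p q) => s i; have := fE s i; rewrite phiE.
Qed.

End CellMaps.

(** If the cell map exchanges rows and columns, composing with [arrV n], which transposes the grid,
    restores the two directions. *)
Lemma cell_aut_eq n (f : {perm arrangement n n}) pi :
    0 < n -> (forall s, injective (pi s)) ->
    (forall s t i, s.[i] = t.[i] ->
       pi s i = pi t i /\ (f s).[pi s i] = (f t).[pi t i]) ->
  f \in (arrP_Sym n n * arrQ_Sym n n) * <[arrV n]>.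
Proof.
move=> n_gt0 pi_inj pi_coh.
have [phi [phi_inj phi_col fE]] := cell_map_ex (leqnn n) pi_inj pi_coh.
pose i0 := Ordinal n_gt0.
have [hor | ver] := rook_square phi_inj phi_col.
  have [p [q phiE]] := rook_horizontal phi_inj phi_col i0 i0 hor.
  rewrite -[f]mulg1 mem_mulg ?group1 //.
  by apply: (@cell_perm_PQ _ _ _ p q) => s i; have := fE s i; rewrite phiE.
pose phi' c := ((phi c).2, (phi c).1).
have phi'_inj : injective phi'.
  by move=> c d [e2 e1]; apply: phi_inj; apply: prod_ext.
have phi'_col c d : collinear c d -> collinear (phi' c) (phi' d).
  by move=> cd; rewrite collinear_swap phi_col.
have [p [q phiE]] := rook_horizontal phi'_inj phi'_col i0 i0 ver.
rewrite -[f](mulgK (arrV n)) mem_mulg ?groupV ?cycle_id //.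
apply: (@cell_perm_PQ _ _ _ p q) => s i.
by have /arrVP := fE s i; rewrite permM; case: (phiE i s.[i]) => <- <-.
Qed.

Lemma ord_notin_ex n (r : seq 'I_n) : size r < n -> exists a, a \notin r.
Proof.
move=> lt_rn; have [/existsP // | /existsPn r_all] := boolP [exists a, a \notin r].
have: #|'I_n| <= size r.
  apply: leq_trans (card_size r); apply/subset_leq_card/subsetP => a _.
  by have := r_all a; rewrite negbK.
by rewrite card_ord leqNgt lt_rn.
Qed.

Lemma arr_not_const n k (i j : 'I_k) (a b : 'I_n) : 2 < n -> k <= n -> i != j ->
  exists s : arrangement n k, s.[i] = a /\ s.[j] != b.
Proof.
move=> n_gt2 le_kn ij; have [c] := @ord_notin_ex _ [:: a; b] n_gt2.
rewrite !inE negb_or eq_sym => /andP[ac cb].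
by have [s si sj] := arr_cell2_ex le_kn ij ac; exists s; rewrite sj.
Qed.

(** * The direct product of value and coordinate permutations *)

Section DirectProduct.

Variables n k : nat.
Hypotheses (n_gt2 : 2 < n) (le_kn : k <= n).
Implicit Types s t : arrangement n k.

(** If a value permutation [g] acts as a coordinate permutation [h], then [t.[h^-1 i]] is [g t.[i]];
    for [h^-1 i != i] this would tie two positions together in every arrangement. *)
Lemma arrP_arrQ_TI : arrP_Sym n k :&: arrQ_Sym n k = 1.
Proof.
apply/trivgP/subsetP=> _ /setIP[/imsetP[g _ ->] /imsetP[h _ eq_gh]].
rewrite inE eq_gh; apply/eqP/permP => s; apply: arr_ext => i.
rewrite perm1 arrQE; congr (_ .[_]); have gE t j : g t.[j] = t.[h^-1 j].
  by rewrite -arrQE -eq_gh arrPE.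
apply/eqP/negPn/negP => ne_i; rewrite eq_sym in ne_i.
have [t [ti]] := arr_not_const s.[i] (g s.[i]) n_gt2 le_kn ne_i.
by rewrite -gE ti eqxx.
Qed.

Lemma arrPQ_dprod :
  arrP_Sym n k \x arrQ_Sym n k = arrP_Sym n k * arrQ_Sym n k.
Proof.
apply: dprodE arrP_arrQ_TI; apply/centsP => _ /imsetP[h _ ->] _ /imsetP[g _ ->].
exact/commute_sym/arrPQ_comm.
Qed.

Lemma arrPQ_group_set : group_set (arrP_Sym n k * arrQ_Sym n k).
Proof.
apply/comm_group_setP/normC/cents_norm/centsP.
by move=> _ /imsetP[g _ ->] _ /imsetP[h _ ->]; apply: arrPQ_comm.
Qed.
Canonical arrPQ_group := Group arrPQ_group_set.

Lemma arrPQ_aut r :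
  arrP_Sym n k * arrQ_Sym n k \subset graph_aut (@arr_adj n k r).
Proof.
rewrite mul_subG //; apply/subsetP => _ /imsetP[g _ ->].
  exact: arrP_aut.
exact: arrQ_aut.
Qed.

End DirectProduct.

(** * Inversion and the semidirect product *)

Section InversionGroup.

Variable n : nat.
Hypothesis n_gt2 : 2 < n.
Implicit Types s t : arrangement n n.

Lemma arrVE s i j : ((arrV n s).[j] == i) = (s.[i] == j).
Proof.
apply/eqP/eqP => [<- | /arrVP //].
have /codomP[l ->] := injF_onto (@arr_inj _ _ s) j.
by rewrite (arrVP (erefl s.[l])).
Qed.

Lemma arrVK s : arrV n (arrV n s) = s.
Proof.
by apply: arr_ext => i; apply/eqP; rewrite !arrVE.
Qed.

(** [s] and [t] differ at position [i] exactly when their inverses differ at position [s.[i]]. *)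
Lemma arrV_aut r : arrV n \in graph_aut (@arr_adj n n r).
Proof.
apply/graph_autP => s t; congr (_ == _).
rewrite -[RHS](card_imset _ (@arr_inj _ _ s)); apply: eq_card => j.
have /codomP[i ->] := injF_onto (@arr_inj _ _ s) j.
rewrite mem_imset ?inE; last exact: arr_inj.
by rewrite (arrVP (erefl s.[i])) eq_sym arrVE eq_sym.
Qed.

(** Otherwise [s.[h^-1 s.[l]]] does not depend on [s]. For [i != h^-1 a], the value [a] at position
    [i] would then determine the value at position [h^-1 a]. *)
Lemma arrV_notin_PQ : arrV n \notin arrP_Sym n n * arrQ_Sym n n.
Proof.
apply/negP => /mulsgP[_ _ /imsetP[g _ ->] /imsetP[h _ ->] VE].
have hE s l : s.[h^-1 s.[l]] = g^-1 l.
  by apply: (@perm_inj _ g); rewrite permKV -arrPE -arrQE -permM -VE; apply: arrVP.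
pose a := Ordinal (ltnW (ltnW n_gt2)).
have [i] := @ord_notin_ex _ [:: h^-1 a] (ltnW n_gt2); rewrite inE => ne_i.
have [t [ti]] := arr_not_const a (g^-1 i) n_gt2 (leqnn n) ne_i.
by rewrite -(hE t) ti eqxx.
Qed.

Lemma arrV_order : #[arrV n] = 2.
Proof.
apply: nt_prime_order => //.
  by apply/permP => s; rewrite expgS expg1 permM perm1 arrVK.
by apply: contraNneq arrV_notin_PQ => ->; apply: group1.
Qed.

Lemma arrV_conjP (g : 'S_n) : arrP n g ^ arrV n = arrQ n g.
Proof.
have VV : (arrV n)^-1 = arrV n.
  by apply/permP => s; apply: (@perm_inj _ (arrV n)); rewrite permKV arrVK.
apply/permP => s; apply: arr_ext => i; rewrite conjgE VV !permM arrQE.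
by apply: arrVP; rewrite arrPE (arrVP (erefl _)) permKV.
Qed.

(** Inversion exchanges the two factors, so it normalises their product; it has prime order and lies
    outside the product, so the intersection is trivial. *)
Lemma arrPQV_sdprod :
  (arrP_Sym n n \x arrQ_Sym n n) ><| <[arrV n]>
    = (arrP_Sym n n * arrQ_Sym n n) * <[arrV n]>.
Proof.
have VV : (arrV n) * (arrV n) = 1 by rewrite -(expg_order (arrV n)) arrV_order.
rewrite (arrPQ_dprod n_gt2 (leqnn n)); apply: sdprodE.
  rewrite cycle_subG inE; apply/subsetP => _ /imsetP[x /mulsgP x_PQ ->].
  have [_ _ /imsetP[g _ ->] /imsetP[h _ ->] ->] := x_PQ.
  rewrite conjMg arrV_conjP.
  (* As an involution, [arrV n] also conjugates [arrQ n h] to [arrP n h]. *)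
  rewrite -(arrV_conjP h) -conjgM VV conjg1 -arrPQ_comm.
  by rewrite mem_mulg ?imset_f.
rewrite setIC prime_TIg //; first by rewrite -orderE arrV_order.
by rewrite cycle_subG arrV_notin_PQ.
Qed.

End InversionGroup.

(** * The transposition graph *)

Section Transpositions.

Variable T : finType.
Implicit Types (x y z v w : T) (u a b c : {perm T}).

Definition moved u := [set x | u x != x].
Definition transp u := [exists x, exists y, (x != y) && (u == tperm x y)].

Lemma in_moved u x : (x \in moved u) = (u x != x).
Proof. by rewrite inE. Qed.

Lemma transpP u : reflect (exists x y, x != y /\ u = tperm x y) (transp u).
Proof.
apply: (iffP existsP) => [[x /existsP[y /andP[xy /eqP->]]] | [x [y [xy ->]]]].
  by exists x, y.
by exists x; apply/existsP; exists y; rewrite xy eqxx.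
Qed.

Lemma transp_tperm x y : x != y -> transp (tperm x y).
Proof. by move=> xy; apply/transpP; exists x, y. Qed.

Lemma transpV u : transp u -> u^-1 = u.
Proof. by case/transpP=> x [y [_ ->]]; rewrite tpermV. Qed.

Lemma transpJ u a : transp u -> transp (u ^ a).
Proof.
case/transpP=> x [y [xy ->]]; rewrite tpermJ transp_tperm //.
by rewrite (inj_eq perm_inj).
Qed.

Lemma moved_tperm x y : x != y -> moved (tperm x y) = [set x; y].
Proof.
move=> xy; apply/setP => z; rewrite !inE.
by case: tpermP => [-> | -> | /eqP/negPf-> /eqP/negPf->]; rewrite ?eqxx ?orbT // eq_sym.
Qed.

Lemma moved_eq0 u : (moved u == set0) = (u == 1).
Proof.
apply/eqP/eqP => [u0 | ->]; last by apply/setP => x; rewrite !inE perm1 eqxx.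
by apply/permP => x; move/setP/(_ x): u0; rewrite !inE perm1 => /negbFE/eqP.
Qed.

Lemma transp_movedE u x y :
  transp u -> x != y -> x \in moved u -> y \in moved u -> u = tperm x y.
Proof.
case/transpP=> z [w [zw ->]] xy; rewrite moved_tperm // => xm ym; move: xy.
by case/set2P: xm => ->; case/set2P: ym => -> //; rewrite ?eqxx // tpermC.
Qed.

Lemma transp_at u x : transp u -> x \in moved u ->
  exists2 y, x != y & u = tperm x y.
Proof.
move=> tu xu; have xux : x != u x by rewrite inE eq_sym in xu.
exists (u x) => //; apply: transp_movedE => //.
by rewrite inE (inj_eq perm_inj) eq_sym.
Qed.

Lemma card_moved u : transp u -> #|moved u| = 2.
Proof. by case/transpP=> x [y [xy ->]]; rewrite moved_tperm // cards2 xy. Qed.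

Lemma transp_moved_inj a b : transp a -> transp b -> moved a \subset moved b -> a = b.
Proof.
move=> /transpP[x [y [xy ->]]] tb; rewrite moved_tperm // => /subsetP sub.
by rewrite -(transp_movedE tb xy) // sub // ?set21 ?set22.
Qed.

(** A point moved by [a] and sent back by [b] would lie, with its image, in both supports, which
    forces [a = b]. *)
Lemma moved_mul a b : transp a -> transp b -> a != b ->
  moved (a * b) = moved a :|: moved b.
Proof.
move=> ta tb ab; apply/setP => x; rewrite !inE permM.
have [-> // | ax] := eqVneq (a x) x.
apply: contraNneq ab => bax; have xa : x != a x by rewrite eq_sym.
have axa : a x \in moved a by rewrite inE (inj_eq perm_inj).
have xm : x \in moved a by rewrite inE.
have xb : x \in moved b.
  by rewrite inE; apply: contraNneq ax => bx; rewrite -(inj_eq (@perm_inj _ b)) bax bx.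
have axb : a x \in moved b by rewrite inE bax.
by apply/eqP; rewrite (transp_movedE tb xa xb axb); apply: transp_movedE.
Qed.

(* [a^-1 * u] and [b^-1 * u] are transpositions when [u] is a common neighbour
   of [a] and [b] in the Cayley graph of the transpositions. *)
Lemma disjoint_common a b u :
    transp a -> transp b -> [disjoint moved a & moved b] -> u != 1 ->
    transp (a^-1 * u) -> transp (b^-1 * u) ->
  u = a * b.
Proof.
move=> ta tb dis_ab u1; set c := a^-1 * u; set d := b^-1 * u => tc td.
have def_u : u = a * c by rewrite mulKVg.
(* [u] cancels in [c * d^-1], so [c * d] and [a * b] are two factorisations of one permutation;
   comparing supports makes [c] and [d] disjoint too. *)
have cd : c * d = a * b.
  by rewrite -[X in _ * X](transpV td) invMg invgK mulgA mulgK (transpV ta).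
have ne_ab : a != b.
  apply: contraTneq dis_ab => ->; rewrite -setI_eq0 setIid -cards_eq0.
  by rewrite card_moved.
have ne_cd : c != d by rewrite (inj_eq (mulIg u)) (inj_eq invg_inj).
have mcd : moved c :|: moved d = moved a :|: moved b by rewrite -!moved_mul ?cd.
have dis_cd : [disjoint moved c & moved d].
  have := cardsUI (moved c) (moved d).
  rewrite mcd cardsU (disjoint_setI0 dis_ab) cards0 !card_moved // subn0.
  by rewrite -[RHS]addn0 => /addnI/eqP; rewrite cards_eq0 setI_eq0.
have [x [y [xy def_c]]] := transpP _ tc.
have mx : x \in moved c by rewrite def_c moved_tperm // set21.
have my : y \in moved c by rewrite def_c moved_tperm // set22.
have dx : d x = x.
  by have := disjointFr dis_cd mx; rewrite inE => /negbFE/eqP.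
have bay : b (a y) = x by rewrite -permM -cd permM def_c tpermR.
(* The point [y] tells which factor [c] is: [c = a] gives [u = 1], and [c = b] gives [u = a * b]. *)
have : y \in moved a :|: moved b by rewrite -mcd inE my.
case/setUP => [ya | yb].
  have ay : a y \in moved a by rewrite !inE in ya *; rewrite (inj_eq perm_inj).
  have bay' : b (a y) = a y.
    by have := disjointFr dis_ab ay; rewrite inE => /negbFE/eqP.
  case/eqP: u1; rewrite def_u def_c -(@transp_movedE a x y) // ?mulgg //.
    by rewrite -[X in X * a](transpV ta) mulVg.
  by rewrite -bay bay'.
have ay : a y = y.
  by have := disjointFl dis_ab yb; rewrite inE => /negbFE/eqP.
rewrite def_u def_c; congr (_ * _); apply/esym/transp_movedE => //.
by rewrite -bay ay !inE in yb *; rewrite (inj_eq perm_inj).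
Qed.

(** [tperm v x * tperm v w] is the product of the transpositions [tperm v x * u] and
    [tperm v w * u], so the first of these has support in [[set v; x; w]]. Taking [w = y] and
    [w = z] leaves the support [[set v; x]], whence [u = 1]. *)
Lemma star_no_common v x y z u :
    v != x -> v != y -> v != z -> x != y -> x != z -> y != z -> u != 1 ->
    transp ((tperm v x)^-1 * u) -> transp ((tperm v y)^-1 * u) ->
  ~~ transp ((tperm v z)^-1 * u).
Proof.
move=> vx vy vz xy xz yz u1; rewrite !tpermV => tx ty; apply/negP => tz.
have sub w : v != w -> x != w -> transp (tperm v w * u) ->
    moved (tperm v x * u) \subset [set v; x; w].
  move=> vw xw tw; have : moved (tperm v x * tperm v w) \subset [set v; x; w].
    apply/subsetP => p; rewrite !inE permM; apply: contraR; rewrite !negb_or.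
    by case/andP=> /andP[pv px] pw; rewrite !tpermD // eq_sym.
  have -> : tperm v x * tperm v w = (tperm v x * u) * (tperm v w * u).
    by rewrite -[X in _ = _ * X](transpV tw) invMg tpermV mulgA mulgK.
  rewrite moved_mul ?subUset => [/andP[] // | | | ] //.
  rewrite (inj_eq (mulIg u)); apply: contraNneq xw => e.
  by rewrite -(tpermL v x) e tpermL.
case/eqP: u1; rewrite -[u](mulKg (tperm v x)) tpermV.
rewrite [X in _ * X](@transp_moved_inj _ (tperm v x)) ?tperm2 ?transp_tperm //.
rewrite moved_tperm //; apply/subsetP => p pm.
move/subsetP/(_ p pm): (sub y vy xy ty); move/subsetP/(_ p pm): (sub z vz xz tz).
rewrite !inE; case/orP=> [// | /eqP->]; rewrite ![z == _]eq_sym.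
by rewrite (negPf yz) orbF.
Qed.

(** [u] is a 3-cycle on the triangle, and cancelling any side on the left leaves another side. *)
Lemma triangle_common v x y : v != x -> v != y -> x != y ->
  let u := tperm v x * tperm v y in
  [/\ u != 1, transp ((tperm v x)^-1 * u), transp ((tperm v y)^-1 * u)
    & transp ((tperm x y)^-1 * u)].
Proof.
move=> vx vy xy u; rewrite /u; split.
- rewrite -moved_eq0 moved_mul ?transp_tperm //.
    by apply/set0Pn; exists v; rewrite moved_tperm // !inE eqxx.
  by apply: contraNneq xy => e; rewrite -(tpermL v x) e tpermL.
- by rewrite mulKg transp_tperm.
- by rewrite -conjgE transpJ ?transp_tperm.
suff -> : (tperm x y)^-1 * (tperm v x * tperm v y) = tperm v x.
  by rewrite transp_tperm.
rewrite tpermV; apply/permP => z; rewrite !permM.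
case: (tpermP x y z) => [-> | -> | zx zy].
- by rewrite (tpermD vy xy) tpermR tpermR.
- by rewrite tpermR tpermL tpermD // eq_sym.
case: (tpermP v x z) => [_ | // | zv _]; first by rewrite tpermD // eq_sym.
by rewrite tpermD // eq_sym; apply/eqP.
Qed.

End Transpositions.

(** * Automorphisms of the transposition Cayley graph fixing the identity *)

Section TranspositionGraph.

Variables (n : nat) (theta : 'S_n -> 'S_n).
Hypotheses (n_gt2 : 2 < n) (theta_bij : bijective theta) (theta1 : theta 1 = 1).
Hypothesis thetaT :
  forall u v, transp ((theta u)^-1 * theta v) = transp (u^-1 * v).

Let theta_inj : injective theta := bij_inj theta_bij.

Lemma theta_neq1 u : (theta u != 1) = (u != 1).
Proof. by rewrite -{1}theta1 (inj_eq theta_inj). Qed.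

Lemma theta_transp i j : i != j -> transp (theta (tperm i j)).
Proof.
by move=> ij; have := thetaT 1 (tperm i j); rewrite theta1 !invg1 !mul1g => ->;
  rewrite transp_tperm.
Qed.

(** [tperm i x] and [tperm i y] have two common neighbours besides [1], the 3-cycles on [i], [x],
    [y], whereas disjoint transpositions have only their product. *)
Lemma theta_star_meet i x y : i != x -> i != y -> x != y ->
  exists v, v \in moved (theta (tperm i x)) :&: moved (theta (tperm i y)).
Proof.
move=> ix iy xy; apply/set0Pn; rewrite setI_eq0; apply/negP => dis.
have [u1 ux uy _] := triangle_common ix iy xy.
have [w1 wy wx _] := triangle_common iy ix (negbT (etrans (eq_sym y x) (negPf xy))).
have : theta (tperm i x * tperm i y) = theta (tperm i y * tperm i x).
  transitivity (theta (tperm i x) * theta (tperm i y)).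
    by apply: disjoint_common; rewrite ?theta_transp ?thetaT ?theta_neq1.
  by apply/esym/disjoint_common; rewrite ?theta_transp ?thetaT ?theta_neq1.
move/theta_inj/permP/(_ x); rewrite !permM tpermR tpermL.
rewrite (tpermD ix) 1?eq_sym // tpermR => yi.
by rewrite yi eqxx in iy.
Qed.

(* Three pairs through [i] have no common neighbour other than [1], whereas the
   three sides of a triangle have one. *)
Lemma theta_star i : exists v, forall j, i != j -> v \in moved (theta (tperm i j)).
Proof.
have [x] := @ord_notin_ex n [:: i] (ltnW n_gt2); rewrite inE eq_sym => ix.
have [y] := @ord_notin_ex n [:: i; x] n_gt2.
rewrite !inE negb_or ![y == _]eq_sym => /andP[iy xy].
have [v /setIP[vx vy]] := theta_star_meet ix iy xy; exists v => z iz.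
have [-> // | zx] := eqVneq z x; have [-> // | zy] := eqVneq z y.
rewrite eq_sym in zx; rewrite eq_sym in zy.
have [b vb def_x] := transp_at (theta_transp ix) vx.
have [d vd def_y] := transp_at (theta_transp iy) vy.
have bd : b != d.
  apply: contraNneq xy => bd.
  have /theta_inj/permP/(_ i) : theta (tperm i x) = theta (tperm i y).
    by rewrite def_x def_y bd.
  by rewrite !tpermL => ->.
apply/negPn/negP => v_notin.
(* If the third image misses [v], it meets the other two in [b] and [d], so the three images form a
   triangle. *)
have in_z c j : i != j -> j != z -> theta (tperm i j) = tperm v c -> v != c ->
    c \in moved (theta (tperm i z)).
  move=> ij jz def_j vc; have [w /setIP[]] := theta_star_meet ij iz jz.
  rewrite def_j moved_tperm // => /set2P[-> | -> //].
  by rewrite (negPf v_notin).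
have bz := in_z b x ix zx def_x vb; have dz := in_z d y iy zy def_y vd.
have def_z := transp_movedE (theta_transp iz) bd bz dz.
have [psi thetaK psiK] := theta_bij.
have [] := triangle_common vb vd bd.
(* The 3-cycle on this triangle is pulled back along [theta] to a common neighbour of the star. *)
rewrite -def_x -def_y -def_z -[_ * _]psiK !thetaT theta_neq1 => u1 ux uy uz.
by have := star_no_common ix iy iz xy zx zy u1 ux uy; rewrite uz.
Qed.

(** [pi i] is a point common to the images of all pairs through [i]. If [pi i = pi j], the images of
    the sides of a triangle [l], [i], [j] would form a star, although the sides have a common
    neighbour other than [1]. *)
Lemma theta_tperm : exists2 pi : 'I_n -> 'I_n, injective pi &
  forall i j, i != j -> theta (tperm i j) = tperm (pi i) (pi j).
Proof.
have [pi piP] : exists pi : 'I_n -> 'I_n, forall i j,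
    i != j -> pi i \in moved (theta (tperm i j)).
  exact: (@fin_all_exists _ _ (fun i v =>
    forall j, i != j -> v \in moved (theta (tperm i j))) theta_star).
have pi_inj : injective pi.
  move=> i j eq_ij; apply/eqP/negPn/negP => ij.
  have [l] := @ord_notin_ex n [:: i; j] n_gt2.
  rewrite !inE negb_or => /andP[li lj].
  have [u1 ui uj uij] := triangle_common li lj ij.
  have vb : pi i \in moved (theta (tperm l i)) by rewrite tpermC piP // eq_sym.
  have vc : pi i \in moved (theta (tperm l j)) by rewrite eq_ij tpermC piP // eq_sym.
  have [b {}vb def_b] := transp_at (theta_transp li) vb.
  have [c {}vc def_c] := transp_at (theta_transp lj) vc.
  have [d vd def_d] := transp_at (theta_transp ij) (piP _ _ ij).
  rewrite -thetaT def_b in ui; rewrite -thetaT def_c in uj.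
  rewrite -thetaT def_d in uij; rewrite -theta_neq1 in u1.
  have ne x y x' y' e e' : theta (tperm x y) = tperm (pi i) e ->
      theta (tperm x' y') = tperm (pi i) e' -> tperm x y x != tperm x' y' x -> e != e'.
    move=> def_e def_e'; apply: contraNneq => ee'; rewrite ee' -def_e' in def_e.
    by rewrite (theta_inj def_e).
  have bc : b != c by apply: (ne _ _ _ _ _ _ def_b def_c); rewrite !tpermL.
  have bd : b != d
    by apply: (ne _ _ _ _ _ _ def_b def_d); rewrite tpermL tpermD // eq_sym.
  have cd : c != d
    by apply: (ne _ _ _ _ _ _ def_c def_d); rewrite tpermL tpermD // eq_sym.
  by have := star_no_common vb vc vd bc bd cd u1 ui uj; rewrite uij.
exists pi => // i j ij; apply: transp_movedE; rewrite ?theta_transp ?piP //.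
  by rewrite (inj_eq pi_inj).
by rewrite tpermC piP // eq_sym.
Qed.

End TranspositionGraph.

Lemma card_moved_transp (T : finType) (u : {perm T}) : (#|moved u| == 2) = transp u.
Proof.
apply/cards2P/idP => [[x [y [xy mu]]] | /transpP[x [y [xy ->]]]]; last first.
  by exists x, y; rewrite moved_tperm.
have mE z : (u z != z) = (z \in [set x; y]) by rewrite -mu inE.
have mux z : z \in [set x; y] -> u z \in [set x; y] /\ u z != z.
  by rewrite -!mE (inj_eq perm_inj).
apply/transpP; exists x, y; split=> //; apply/permP => z.
case: tpermP => [-> | -> | /eqP zx /eqP zy].
- by have [/set2P[-> | //] /eqP] := mux x (set21 x y).
- by have [/set2P[// | ->] /eqP] := mux y (set22 x y).
by apply/eqP/negbNE; rewrite mE !inE negb_or zx.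
Qed.

(** * The case [k = n] as a Cayley graph *)

Section SquareArrangements.

Variable n : nat.
Implicit Types (s t : arrangement n n) (u w : 'S_n).

Lemma arrQ_free s u w : arrQ n u s = arrQ n w s -> u = w.
Proof.
move=> uw; apply: invg_inj; apply/permP => i; apply: (@arr_inj _ _ s).
by rewrite -!arrQE uw.
Qed.

Lemma arrQ_transitive s t : exists u, t = arrQ n u s.
Proof.
have g_inj : injective (fun i => invF (@arr_inj _ _ s) t.[i]).
  by apply: inj_comp (@arr_inj _ _ t); apply: can_inj (f_invF _).
exists (perm g_inj)^-1; apply: arr_ext => i.
by rewrite arrQE invgK permE f_invF.
Qed.

(** Coordinate permutations act regularly on the vertices, so this identifies the graph with the
    Cayley graph of the symmetric group for the transpositions. *)
Lemma arr_adj2E s u w : arr_adj 2 (arrQ n u s) (arrQ n w s) = transp (u^-1 * w).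
Proof.
rewrite -card_moved_transp; congr (_ == _); apply: eq_card => i.
rewrite !inE !arrQE (inj_eq (@arr_inj _ _ s)) permM.
by rewrite (can2_eq (permK w) (permKV w)).
Qed.

End SquareArrangements.

(** * Automorphisms for [r = 2], [k = n] *)

Section TranspositionAutomorphism.

Variables (n : nat) (f : {perm arrangement n n}).
Hypotheses (n_gt2 : 2 < n) (f_aut : f \in graph_aut (@arr_adj n n 2)).
Implicit Types s t : arrangement n n.

Lemma arr_adj2_local : exists theta : arrangement n n -> 'S_n -> 'S_n,
  forall s u, f (arrQ n u s) = arrQ n (theta s u) (f s).
Proof.
have [theta thetaP] : exists theta : arrangement n n * 'S_n -> 'S_n,
    forall c, f (arrQ n c.2 c.1) = arrQ n (theta c) (f c.1).
  apply: (@fin_all_exists _ _ (fun c w => f (arrQ n c.2 c.1) = arrQ n w (f c.1))).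
  by move=> c; apply: arrQ_transitive.
by exists (fun s u => theta (s, u)) => s u; have := thetaP (s, u).
Qed.

(** With [s] and [f s] as base points, [f] becomes [theta s], which gives a bijection [pi s] of the
    positions. For coherence at [l] it suffices to follow one transposition of two other positions,
    since these connect the arrangements through a cell. *)
Lemma transposition_aut : f \in (arrP_Sym n n * arrQ_Sym n n) * <[arrV n]>.
Proof.
have [theta thetaP] := arr_adj2_local.
have theta1 s : theta s 1 = 1.
  by apply: (@arrQ_free _ (f s)); rewrite -thetaP !arrQ1 !perm1.
have theta_bij s : bijective (theta s).
  apply: injF_bij => u w uw; apply: (@arrQ_free _ s); apply: (@perm_inj _ f).
  by rewrite !thetaP uw.
have thetaT s u w : transp ((theta s u)^-1 * theta s w) = transp (u^-1 * w).
  by rewrite -(arr_adj2E (f s)) -!thetaP (graph_autP _ _ f_aut) arr_adj2E.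
have [pi piP] : exists pi : arrangement n n -> 'I_n -> 'I_n, forall s,
    injective (pi s) /\
    forall i j, i != j -> theta s (tperm i j) = tperm (pi s i) (pi s j).
  apply: (@fin_all_exists _ _ (fun s p => injective p /\
    forall i j, i != j -> theta s (tperm i j) = tperm (p i) (p j))) => s.
  have [p p_inj pE] := theta_tperm n_gt2 (theta_bij s) (theta1 s) (thetaT s).
  by exists p.
have pi_inj s := (piP s).1; have piE s := (piP s).2 => {piP}.
apply: (@cell_aut_eq n f pi) => //; first exact: ltnW (ltnW n_gt2).
have step s i j l : i != j -> i != l -> j != l ->
    let t := arrQ n (tperm i j) s in
    pi t l = pi s l /\ (f t).[pi t l] = (f s).[pi s l].
  move=> ij il jl t.
  have ft : f t = arrQ n (theta s (tperm i j)) (f s) by apply: thetaP.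
  (* Moving the base point from [s] to [t] translates both the argument and the value of [theta]. *)
  have tE u : theta t u =
      (theta s (tperm i j))^-1 * theta s (tperm i j * u).
    apply: (@arrQ_free _ (f t)); rewrite -thetaP ft -permM -arrQM mulKVg -thetaP.
    by rewrite arrQM permM.
  have pi_ij : [set pi t i; pi t j] = [set pi s i; pi s j].
    rewrite -!moved_tperm ?(inj_eq (@pi_inj _)) // -!piE // tE tperm2 theta1.
    by rewrite mulg1 piE // tpermV.
  (* The 3-cycle [u] is a common neighbour of [tperm i j] and [tperm i l]. Comparing its image with
     theirs writes [d * b] as a product of two transpositions on these three points, so the support
     of [b], which contains [pi t l], is among them. *)
  have l_in : pi t l \in [set pi s l; pi s i; pi s j].
    have li : l != i by rewrite eq_sym.
    have ji : j != i by rewrite eq_sym.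
    have lj : l != j by rewrite eq_sym.
    have pi_ne x y : x != y -> pi s x != pi s y by rewrite (inj_eq (@pi_inj s)).
    have ptl : pi t l != pi t j by rewrite (inj_eq (@pi_inj t)).
    have [_ _ _] := triangle_common ji jl il; set u := tperm j i * tperm j l.
    rewrite -(thetaT s) piE // => tu; set b := tperm (pi t l) (pi t j).
    have bE : theta s u = tperm (pi s i) (pi s j) * b.
      by rewrite /b -(piE t) // tE !piE // mulKVg tpermC (tpermC l).
    rewrite bE tpermV in tu; have tb : transp b by rewrite transp_tperm.
    set d := tperm (pi s i) (pi s l) * _ in tu.
    have db : d * b = tperm (pi s i) (pi s l) * tperm (pi s i) (pi s j).
      by rewrite /d -!mulgA tperm2 mulg1.
    have [db1 _ _ _] := triangle_common (pi_ne i l il) (pi_ne i j ij) (pi_ne l j lj).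
    have ne_db : d != b by apply: contraNneq db1 => e; rewrite -db e tperm2.
    have : pi t l \in moved (d * b).
      by rewrite moved_mul // in_setU (moved_tperm ptl) set21 orbT.
    rewrite db moved_mul ?transp_tperm ?pi_ne // => [|{ne_db db1}].
      rewrite !moved_tperm ?pi_ne // !inE.
      by case/orP=> /orP[] ->; rewrite ?orbT.
    apply: contraNneq (pi_ne _ _ lj) => e.
    by rewrite -(tpermL (pi s i) (pi s l)) e tpermL.
  have pi_l : pi t l = pi s l.
    move: l_in; rewrite -setUA in_setU1 -pi_ij in_set2.
    rewrite !(inj_eq (@pi_inj t)) ![l == _]eq_sym (negPf il) (negPf jl) !orbF.
    by move/eqP.
  rewrite pi_l ft piE // arrQE tpermV tpermD //.
    by rewrite (inj_eq (@pi_inj s)).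
  by rewrite (inj_eq (@pi_inj s)).
move=> s t l st_l; pose c s := (pi s l, (f s).[pi s l]).
suff [-> ->] : c s = c t by [].
apply: (@arr_cell_conn _ _ _ c l s.[l]) => // {st_l t}s' u v s'l.
case/codomP=> i -> iv ui vi.
(* As [k = n], every value occurs in [s'], so exchanging two values amounts to exchanging two
   positions. *)
have [j def_v] : exists j, v = s'.[j].
  by exists (invF (@arr_inj _ _ s') v); rewrite f_invF.
have -> : arrP n (tperm s'.[i] v) s' = arrQ n (tperm i j) s'.
  apply: arr_ext => m.
  by rewrite arrPE arrQE tpermV def_v (inj_tperm _ _ _ (@arr_inj _ _ s')).
have ij : i != j by apply: contraNneq iv => ->; rewrite def_v.
have il : i != l by apply: contraNneq ui => ->; rewrite s'l.
have jl : j != l by apply: contraNneq vi; rewrite def_v -s'l => ->.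
by have [pi_eq f_eq] := step s' i j l ij il jl; rewrite /c f_eq pi_eq.
Qed.

End TranspositionAutomorphism.

(** * Common neighbours when r = k < n *)

(** The fixed point [x] of [u] is spliced into the cycle of [y]. *)
Lemma moved_insert (T : finType) (u : {perm T}) x y : u x = x -> x != y ->
  moved (u * tperm y x) = [set x; y] :|: moved u.
Proof.
move=> ux xy; apply/setP => z; rewrite !inE permM.
have [-> | zx] := eqVneq z x; first by rewrite ux tpermR eq_sym xy.
have uzx : u z != x by rewrite -{1}ux (inj_eq perm_inj).
have [zy /= | zy] := eqVneq z y.
  rewrite zy in uzx *; have [-> | uyy] := eqVneq (u y) y; first by rewrite tpermL xy.
  by rewrite tpermD // eq_sym.
have [uzy | uzy] := eqVneq (u z) y; last by rewrite tpermD // eq_sym.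
by rewrite uzy tpermL ![_ == z]eq_sym zx zy.
Qed.

(** Induction on the size, splicing one point of [A] into a permutation that moves the others. A
    pair is treated apart, since it would leave a singleton. *)
Lemma derangement_ex (T : finType) (A : {set T}) : #|A| != 1%N -> exists u, moved u = A.
Proof.
have [m] := ubnP #|A|; elim: m A => // m IHm A lt_m A_neq1.
have [-> | [x xA]] := set_0Vmem A.
  by exists 1; apply/eqP; rewrite moved_eq0.
have A1 : #|A :\ x| = #|A|.-1 by rewrite (cardsD1 x A) xA.
have A_gt0 : 0 < #|A| by rewrite (cardsD1 x A) xA.
have [/eqP/cards2P[a [b [ab ->]]] | A_neq2] := eqVneq #|A| 2.
  by exists (tperm a b); rewrite moved_tperm.
have [||u mu] := IHm (A :\ x); rewrite ?A1.
- by rewrite -ltnS prednK.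
- by move: A_neq2 A_gt0 A_neq1; case: #|A| => [|[|[|]]].
have [y] : exists y, y \in A :\ x.
  by apply/set0Pn; rewrite -cards_eq0 A1; case: #|A| A_gt0 A_neq1 => [|[]].
case/setD1P=> yx yA; exists (u * tperm y x).
have ux : u x = x by apply/eqP; have := setD11 x A; rewrite -mu inE => /negbFE.
rewrite moved_insert 1?eq_sym // mu (setUC [set x]) -setUA setD1K //.
by apply/setUidPr; rewrite sub1set.
Qed.

Lemma near_derangement_ex (T : finType) (A : {set T}) z : z \in A ->
  exists2 u, moved u \subset A & A :\ z \subset moved u.
Proof.
move=> zA; have [A1 | /derangement_ex[u mu]] := eqVneq #|A| 1%N.
  exists 1; first by apply/subsetP => x; rewrite inE perm1 eqxx.
  move/eqP/cards1P: A1 zA => [x ->]; rewrite inE => /eqP->.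
  by rewrite setDv sub0set.
by exists u; rewrite mu ?subD1set.
Qed.

(** A permutation of the points other than [p] and [q], moving all but perhaps [z], is extended to
    [p] and [q]; how depends on which of [c = q] and [b = p] hold. *)
Lemma near_derangement_one_of_two (T : finType) (p q b c z : T) :
    p != q -> b != q -> c != p -> b != c -> z != p -> z != q ->
  exists u : {perm T}, (forall x, x != z -> u x != x) /\ (u p == c) != (u q == b).
Proof.
move=> pq bq cp bc zp zq.
have [|u uS Su] := @near_derangement_ex _ (~: [set p; q]) z.
  by rewrite !inE negb_or zp zq.
have fixed x : x \notin ~: [set p; q] -> u x = x.
  by move=> xS; apply/eqP/negbNE; apply: contra xS => xu; rewrite (subsetP uS) ?inE.
have up : u p = p by apply: fixed; rewrite !inE eqxx.
have uq : u q = q by apply: fixed; rewrite !inE eqxx orbT.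
have qp : q != p by rewrite eq_sym.
have uE (w : {perm T}) : [set p; q] :|: moved u \subset moved w ->
    forall x, x != z -> w x != x.
  move=> sub x xz; have : x \in moved w; last by rewrite inE.
  apply: (subsetP sub); rewrite in_setU; have [// | xpq] := boolP (x \in _).
  by rewrite (subsetP Su) // in_setD1 xz in_setC.
(* Exchanging [p] and [q] would satisfy both equations, so [z] is spliced in: [p] goes to [z], and
   [q] to [p = b]. *)
have [/andP[/eqP cq /eqP bp] | not_swap] := boolP ((c == q) && (b == p)).
  have [uzp uzpq] : (u * tperm z p) p = z /\ (u * tperm z p) q = q.
    by rewrite !permM up uq tpermR tpermD // eq_sym.
  exists (u * tperm z p * tperm p q); split.
    apply: uE; rewrite !moved_insert // 1?eq_sym //.
    by apply/subsetP => x; rewrite !inE => /orP[/orP[]|] ->; rewrite ?orbT.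
  rewrite !permM up tpermR uq (tpermD zq) 1?eq_sym // tpermR bp eqxx.
  by rewrite tpermD 1?eq_sym // cq (negPf zq).
have [] := boolP ((c == q) (+) (b == p)) => [one | none].
  exists (u * tperm p q); split.
    by apply: uE; rewrite moved_insert // (setUC [set q]).
  rewrite !permM up uq tpermL tpermR ![q == _]eq_sym ![p == _]eq_sym.
  by move: one; rewrite eq_sym -negb_add negbK addbC.
(* Here [q] is sent to [b], and [p] to [q], which is not [c]. *)
have [cq bp] : c != q /\ b != p.
  by move: not_swap none; case: (c == q); case: (b == p).
have ub : (u * tperm b q) q = b by rewrite permM uq tpermR.
have ubp : (u * tperm b q) p = p by rewrite permM up tpermD // eq_sym.
exists (u * tperm b q * tperm q p); split.
  apply: uE; rewrite !moved_insert // 1?eq_sym //.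
  by apply/subsetP => x; rewrite !inE => /orP[/orP[]|] ->; rewrite ?orbT.
rewrite permM ubp tpermR permM ub tpermD 1?eq_sym // eqxx.
by rewrite (eq_sym q) (negPf cq).
Qed.

Section CommonNeighbours.

Variables n k : nat.
Implicit Types (s t x : arrangement n k) (i j l : 'I_k) (a b : 'I_n).

Definition common s t := #|[set x | arr_adj k s x && arr_adj k t x]|.

Lemma common_aut (f : {perm arrangement n k}) s t :
  f \in graph_aut (@arr_adj n k k) -> common (f s) (f t) = common s t.
Proof.
move/graph_autP=> f_aut; rewrite /common -[RHS](card_imset _ (@perm_inj _ f)).
apply: eq_card => x; rewrite -[x](permKV f) mem_imset ?inE ?f_aut //.
exact: perm_inj.
Qed.

Definition hits s i a := [set x | arr_adj k s x && (x.[i] == a)].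

Lemma arr_adj_swap_value s a b x i :
    a \notin codom (tnth (val s)) -> b != s.[i] -> x.[i] = a -> arr_adj k s x ->
  arr_adj k s (arrP k (tperm a b) x).
Proof.
move=> a_new b_ne xi /arr_adj_fullP sx; apply/arr_adj_fullP => j.
rewrite arrPE; case: tpermP => [xa | xb | _ _] //.
  have -> : j = i by apply: (@arr_inj _ _ x); rewrite xa xi.
  by rewrite eq_sym.
by apply: contraNneq a_new => <-; apply: codom_f.
Qed.

(** Exchanging the values [a] and [b] embeds one set in the other: [a] may go anywhere, as [s] does
    not use it, and [b] only comes to position [i]. *)
Lemma hits_new_le s i a b : a \notin codom (tnth (val s)) -> b != s.[i] ->
  #|hits s i a| <= #|hits s i b|.
Proof.
move=> a_new b_ne; rewrite -(card_imset _ (@perm_inj _ (arrP k (tperm a b)))).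
apply/subset_leq_card/subsetP => y /imsetP[x]; rewrite !inE.
move=> /andP[sx /eqP xi] ->.
by rewrite (arr_adj_swap_value a_new b_ne xi) // arrPE xi tpermL eqxx.
Qed.

Lemma hits_new_pos s i j a : a \notin codom (tnth (val s)) ->
  #|hits s i a| <= #|hits s j a|.
Proof.
move=> a_new; pose g := arrP k (tperm s.[i] s.[j]) * arrQ n (tperm i j).
have gs : g s = s.
  apply: arr_ext => l; rewrite permM arrQE arrPE tpermV.
  by rewrite (inj_tperm _ _ _ (@arr_inj _ _ s)) tpermK.
have g_aut : g \in graph_aut (@arr_adj n k k) by rewrite groupM ?arrP_aut ?arrQ_aut.
rewrite -(card_imset _ (@perm_inj _ g)).
apply/subset_leq_card/subsetP => y /imsetP[x]; rewrite !inE.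
move=> /andP[sx /eqP xi] ->; rewrite -{1}gs (graph_autP _ _ g_aut) sx permM.
rewrite arrQE tpermV tpermR arrPE xi tpermD ?eqxx //;
  by apply: contraNneq a_new => <-; apply: codom_f.
Qed.

(** A neighbour of [s] differs from [t] outside [i], so it fails to be a neighbour of [t] exactly
    when it takes the value [t.[i]] at [i]. *)
Lemma common_adj1 s t i : s.[i] != t.[i] -> (forall j, j != i -> s.[j] = t.[j]) ->
  (common s t + #|hits s i t.[i]|)%N = #|[set x | arr_adj k s x]|.
Proof.
move=> ne_i eq_st; rewrite -[RHS](cardsID (hits s i t.[i])) addnC.
congr (_ + _)%N; apply: eq_card => x; rewrite !inE; first by case: arr_adj.
have [sx /= | //] := boolP (arr_adj k s x); rewrite andbT.
apply/arr_adj_fullP/idP => [tx | xt j]; first by rewrite eq_sym.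
have [-> | ji] := eqVneq j i; first by rewrite eq_sym.
by rewrite -eq_st //; apply: (arr_adj_fullP _ _ sx).
Qed.

Lemma hits_one_of_two s t z i j : z \notin codom (tnth (val s)) -> i != j ->
    s.[i] != t.[i] -> s.[j] != t.[j] ->
  exists2 x, arr_adj k s x & (x.[i] == t.[i]) != (x.[j] == t.[j]).
Proof.
move=> z_new ij st_i st_j.
have z_ne l : z != s.[l] by apply: contraNneq z_new => ->; apply: codom_f.
have [||||||u [u_ne u_one]] :=
    @near_derangement_one_of_two _ s.[i] s.[j] t.[j] t.[i] z => //.
- by rewrite (inj_eq (@arr_inj _ _ s)).
- by rewrite eq_sym.
- by rewrite eq_sym.
- by rewrite (inj_eq (@arr_inj _ _ t)) eq_sym.
exists (arrP k u s); last by rewrite !arrPE.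
by apply/arr_adj_fullP => l; rewrite arrPE eq_sym u_ne // eq_sym.
Qed.

(** The neighbours of [s] with value [t.[i]] at [i] are lost, at least [#|hits s l a|] of them. Up
    to exchanging [i] and [j], one more is lost that meets [t] at [j] but not at [i]. *)
Lemma common_far s t i j a l : a \notin codom (tnth (val s)) -> i != j ->
    s.[i] != t.[i] -> s.[j] != t.[j] ->
  common s t + #|hits s l a| < #|[set x | arr_adj k s x]|.
Proof.
move=> a_new ij st_i st_j.
wlog [x sx [xi xj]] : i j ij st_i st_j / exists2 x, arr_adj k s x &
    x.[i] != t.[i] /\ x.[j] = t.[j].
  move=> IH; have [x sx] := hits_one_of_two a_new ij st_i st_j.
  have [xi | xi] := eqVneq x.[i] t.[i]; have [xj | xj] := eqVneq x.[j] t.[j] => // _.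
    by apply: (IH j i) => //; [rewrite eq_sym | exists x].
  by apply: (IH i j) => //; exists x.
have le_i : #|hits s l a| <= #|hits s i t.[i]|.
  apply: leq_trans (hits_new_pos l i a_new) (hits_new_le a_new _).
  by rewrite eq_sym.
have x_notin : x \notin hits s i t.[i] by rewrite inE negb_and xi orbT.
have -> : common s t + #|hits s l a| < #|[set x | arr_adj k s x]|
  = (common s t + #|hits s l a|.+1 <= #|[set x | arr_adj k s x]|) by rewrite addnS.
apply: leq_trans (_ : common s t + #|x |: hits s i t.[i]| <= _).
  by rewrite leq_add2l cardsU1 x_notin ltnS.
rewrite /common -cardsUI (_ : _ :&: _ = set0) ?cards0 ?addn0.
  apply/subset_leq_card/subsetP => y; rewrite !inE.
  by case/or3P => [/andP[] | /eqP-> | /andP[]].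
apply/setP => y; rewrite !inE; apply/negP.
case/andP=> /andP[_ /arr_adj_fullP ty] /orP[/eqP yx | /andP[_ /eqP yi]].
  by have := ty j; rewrite yx xj eqxx.
by have := ty i; rewrite yi eqxx.
Qed.

End CommonNeighbours.

(** * Automorphisms for [r = k < n] *)

Section FullAutomorphism.

Variables n k : nat.
Hypotheses (lt_kn : k < n) (k_gt0 : 0 < k).
Implicit Types (s t x y : arrangement n k) (i j l : 'I_k) (a b : 'I_n).

Lemma hits_new_eq s i j a b :
    a \notin codom (tnth (val s)) -> b \notin codom (tnth (val s)) ->
  #|hits s i a| = #|hits s j b|.
Proof.
have le c d l m : c \notin codom (tnth (val s)) -> d \notin codom (tnth (val s)) ->
    #|hits s l c| <= #|hits s m d|.
  move=> c_new d_new; apply: leq_trans (hits_new_pos l m c_new) (hits_new_le c_new _).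
  by apply: contraNneq d_new => ->; apply: codom_f.
by move=> a_new b_new; apply/eqP; rewrite eqn_leq !le.
Qed.

Lemma adj1_new s t i : s.[i] != t.[i] -> (forall j, j != i -> s.[j] = t.[j]) ->
  t.[i] \notin codom (tnth (val s)).
Proof.
move=> ne_i eq_st; apply/negP => /codomP[j tij].
have [ji | ji] := eqVneq j i; first by rewrite tij ji eqxx in ne_i.
by move: tij; rewrite eq_st // => /(@arr_inj _ _ t) ij; rewrite ij eqxx in ji.
Qed.

Lemma new_ex s : exists a, a \notin codom (tnth (val s)).
Proof. by apply: ord_notin_ex; rewrite size_codom card_ord. Qed.

Lemma adj1_ex s i :
  exists2 t : arrangement n k, s.[i] != t.[i] & forall j, j != i -> s.[j] = t.[j].
Proof.
have [a a_new] := new_ex s; exists (arrP k (tperm s.[i] a) s).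
  by rewrite arrPE tpermL; apply: contraNneq a_new => <-; apply: codom_f.
move=> j ji; rewrite arrPE tpermD // 1?eq_sym.
  by rewrite (inj_eq (@arr_inj _ _ s)).
by apply: contraNneq a_new => <-; apply: codom_f.
Qed.

(** All vertices at one position from [s] miss equally many neighbours of [s], and any further
    vertex misses more. *)
Lemma common_max s t x : arr_adj 1 s t -> x != s ->
  common s x <= common s t ?= iff arr_adj 1 s x.
Proof.
case/arr_adj1P => i ne_i eq_st xs; have t_new := adj1_new ne_i eq_st.
have D := common_adj1 ne_i eq_st.
have [/arr_adj1P[j ne_j eq_sx] | not_adj] := boolP (arr_adj 1 s x).
  have := common_adj1 ne_j eq_sx; rewrite -D.
  rewrite (hits_new_eq j i (adj1_new ne_j eq_sx) t_new) => /addIn ->.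
  exact/leqif_refl.
have [j ne_j] : exists j, s.[j] != x.[j].
  apply/existsP; apply: contraR xs => /existsPn eq_sx.
  by apply/eqP/esym/arr_ext => j; apply/eqP/negbNE/eq_sx.
have [l lj ne_l] : exists2 l, l != j & s.[l] != x.[l].
  apply/exists_inP; apply: contraR not_adj => /exists_inPn eq_sx.
  by apply/arr_adj1P; exists j => // l lj; apply/eqP/negbNE/eq_sx.
apply/leqifP; rewrite -(ltn_add2r #|hits s i t.[i]|) D.
exact: (common_far _ t_new lj ne_l ne_j).
Qed.

(** Differing in one position means attaining the maximum of [common s] over the vertices other than
    [s], and [f] preserves [common]. The preimage of a maximiser [x] for [f s] supplies the reverse
    inequality. *)
Lemma full_adj1 (f : {perm arrangement n k}) s t :
  f \in graph_aut (@arr_adj n k k) -> arr_adj 1 s t -> arr_adj 1 (f s) (f t).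
Proof.
move=> f_aut st; have i0 := Ordinal k_gt0.
have [x ne_x eq_x] := adj1_ex (f s) i0.
have fsx : arr_adj 1 (f s) x by apply/arr_adj1P; exists i0.
have ts : f t != f s.
  rewrite (inj_eq perm_inj); apply: contraTneq st => ->.
  by rewrite arr_adj_irr.
have xs : f^-1 x != s.
  apply: contraTneq fsx => <-; rewrite permKV arr_adj_irr //.
rewrite -(common_max fsx ts).2 eqn_leq (common_max fsx ts).1 /=.
rewrite -[x](permKV f) !common_aut //; exact: (common_max st xs).1.
Qed.

Lemma codom_arrP (g : 'S_n) s a :
  (g a \in codom (tnth (val (arrP k g s)))) = (a \in codom (tnth (val s))).
Proof.
apply/codomP/codomP => -[j aj]; exists j; last by rewrite arrPE aj.
by apply: (@perm_inj _ g); rewrite aj arrPE.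
Qed.

Definition agree s t := [set i | s.[i] == t.[i]].

Lemma agreeC s t : agree s t = agree t s.
Proof. by apply/setP => i; rewrite !inE eq_sym. Qed.

Lemma agree_full s t : (agree s t == set0) = arr_adj k s t.
Proof.
apply/eqP/arr_adj_fullP => [st0 i | st].
  by move/setP/(_ i): st0; rewrite !inE => ->.
by apply/setP => i; rewrite !inE (negPf (st i)).
Qed.

(* Changing [s] at [i] to a new value makes it disjoint from exactly those [x]
   meeting [s] that meet it at [i] only. *)
Lemma full_agree (f : {perm arrangement n k}) s i :
    f \in graph_aut (@arr_adj n k k) ->
  exists j, forall x, agree s x = [set i] -> agree (f s) (f x) = [set j].
Proof.
move=> f_aut; have [t ne_i eq_st] := adj1_ex s i.
have t_new := adj1_new ne_i eq_st.
have /(full_adj1 f_aut)/arr_adj1P[j ne_j eq_j] : arr_adj 1 s t.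
  by apply/arr_adj1P; exists i.
exists j => x sx.
have fsx : agree (f s) (f x) != set0.
  by rewrite agree_full (graph_autP _ _ f_aut) -agree_full sx -card_gt0 cards1.
have ftx : arr_adj k (f t) (f x).
  rewrite (graph_autP _ _ f_aut) -agree_full; apply/eqP/setP => l; rewrite !inE.
  apply/negbTE; have [-> | li] := eqVneq l i.
    have /eqP <- : s.[i] == x.[i] by have := set11 i; rewrite -sx inE.
    by rewrite eq_sym.
  by have := in_set1 l i; rewrite -sx inE eq_st // (negPf li) => ->.
have sub : agree (f s) (f x) \subset [set j].
  apply/subsetP => l; rewrite !inE; apply: contraTT => lj; rewrite eq_j //.
  exact: (arr_adj_fullP _ _ ftx).
by apply/eqP; rewrite eqEcard sub cards1 card_gt0.
Qed.

Hypothesis n_gt2 : 2 < n.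

Lemma agree_ex s i : exists x, agree s x = [set i].
Proof.
have [|u mu] := @derangement_ex _ (~: [set s.[i]]).
  by rewrite cardsC1 card_ord; case: n n_gt2 => [|[|[]]].
exists (arrP k u s); apply/setP => j; rewrite !inE arrPE eq_sym.
have := in_setC1 s.[j] s.[i]; rewrite -mu inE (inj_eq (@arr_inj _ _ s)).
by move/negb_inj.
Qed.

(** [x] arises from [s] by a permutation of the values whose only fixed point is [s.[l]] and which
    sends [s.[i]] to a fourth value [q], different from [t.[i]]. *)
Lemma agree2_ex s t i l : 3 < n -> s.[i] != t.[i] ->
    (forall j, j != i -> s.[j] = t.[j]) -> l != i ->
  exists2 x, agree s x = [set l] & agree t x = [set l].
Proof.
move=> n_gt3 ne_i eq_st li.
have [q] := @ord_notin_ex n [:: s.[l]; s.[i]; t.[i]] n_gt3.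
rewrite !inE !negb_or => /and3P[q_l q_i q_t].
have sli : s.[i] != s.[l] by rewrite (inj_eq (@arr_inj _ _ s)) eq_sym.
have card_A : #|~: [set s.[l]; s.[i]]| != 1%N.
  rewrite cardsCs setCK card_ord cards2 (eq_sym s.[l]) sli.
  by case: n n_gt3 => [|[|[|[]]]].
have [u mu] := derangement_ex card_A.
have ui : u s.[i] = s.[i].
  by apply/eqP/negbNE; rewrite -in_moved mu !inE eqxx orbT.
have uE a : ((u * tperm q s.[i]) a == a) = (a == s.[l]).
  apply: negb_inj; rewrite -in_moved (moved_insert ui) 1?[_ == q]eq_sym // mu.
  rewrite !inE negb_or.
  have [-> | a_i] := eqVneq a s.[i]; first by rewrite sli.
  have [-> | _] := eqVneq a q; first by rewrite q_l.
  by rewrite andbT.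
exists (arrP k (u * tperm q s.[i]) s); apply/setP => j; rewrite !inE arrPE.
  by rewrite eq_sym uE (inj_eq (@arr_inj _ _ s)).
have [-> | ji] := eqVneq j i; last first.
  by rewrite -eq_st // eq_sym uE (inj_eq (@arr_inj _ _ s)).
by rewrite permM ui tpermR eq_sym (negPf q_t) eq_sym (negPf li).
Qed.

(** Coherence of [pi] comes in three stages: for two arrangements with exactly one common cell; for
    two that differ in one position; and in general, by changing one position at a time. *)
Lemma full_aut : graph_aut (@arr_adj n k k) \subset arrP_Sym n k * arrQ_Sym n k.
Proof.
apply/subsetP => f f_aut.
have [pi piP] : exists pi : arrangement n k -> 'I_k -> 'I_k, forall s i x,
    agree s x = [set i] -> agree (f s) (f x) = [set pi s i].
  have [p pP] : exists p : arrangement n k * 'I_k -> 'I_k, forall c x,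
      agree c.1 x = [set c.2] -> agree (f c.1) (f x) = [set p c].
    apply: (@fin_all_exists _ _ (fun c j => forall x : arrangement n k,
      agree c.1 x = [set c.2] -> agree (f c.1) (f x) = [set j])).
    by move=> c; apply: full_agree.
  by exists (fun s i => p (s, i)) => s i x; apply: (pP (s, i)).
(* Arrangements meeting [s] only at [i] and only at [j] are told apart after applying [f] because
   [f^-1] is an automorphism too. *)
have pi_inj s : injective (pi s).
  move=> i j eq_ij; have [x sx] := agree_ex s i; have [y sy] := agree_ex s j.
  have [l lP] := full_agree (f s) (pi s i) (groupVr f_aut).
  have fsy := piP _ _ _ sy; rewrite -eq_ij in fsy.
  have := lP _ (piP _ _ _ sx); have := lP _ fsy.
  by rewrite !permK sx sy => /set1_inj-> /set1_inj.
have link s x l : agree s x = [set l] ->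
    pi x l = pi s l /\ (f x).[pi x l] = (f s).[pi s l].
  move=> sx; have fsx := piP _ _ _ sx.
  have fxs : agree (f x) (f s) = [set pi x l] by apply: piP; rewrite agreeC.
  have pi_eq : pi x l = pi s l by apply: set1_inj; rewrite -fxs agreeC.
  split=> //; rewrite pi_eq; apply/esym/eqP.
  by have := set11 (pi s l); rewrite -fsx inE.
have step1 s t i l : s.[i] != t.[i] -> (forall j, j != i -> s.[j] = t.[j]) ->
    l != i -> pi t l = pi s l /\ (f t).[pi t l] = (f s).[pi s l].
  move=> ne_i eq_st li; have [n_gt3 | n_le3] := ltnP 3 n.
    have [x sx tx] := agree2_ex n_gt3 ne_i eq_st li.
    have [p1 f1] := link _ _ _ sx; have [p2 f2] := link _ _ _ tx.
    by split; [rewrite -p1 -p2 | rewrite -f1 -f2].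
  (* With [n <= 3] there are at most two positions, so [s] and [t] agree only at [l]. *)
  apply: link; apply/setP => j; rewrite !inE.
  have [-> | ji] := eqVneq j i; first by rewrite (negPf ne_i) eq_sym (negPf li).
  rewrite eq_st // eqxx; apply/esym/negPn/negP => jl.
  have: #|i |: [set j; l]| <= 2.
    apply: leq_trans (max_card _) _; rewrite card_ord -ltnS.
    exact: leq_trans lt_kn n_le3.
  by rewrite cardsU1 cards2 !inE ![i == _]eq_sym (negPf ji) (negPf li) jl.
apply: (cell_aut_lt (ltnW lt_kn) k_gt0 pi_inj) => // s t l st_l.
pose c s := (pi s l, (f s).[pi s l]).
suff [-> ->] : c s = c t by [].
have new_step s' u v : s'.[l] = s.[l] -> u \in codom (tnth (val s')) ->
    v \notin codom (tnth (val s')) -> u != s.[l] -> c (arrP k (tperm u v) s') = c s'.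
  move=> s'l /codomP[i ->] v_new ui.
  have ne_v j : v != s'.[j] by apply: contraNneq v_new => ->; apply: codom_f.
  have [|||pi_eq f_eq] := step1 s' (arrP k (tperm s'.[i] v) s') i l.
  - by rewrite arrPE tpermL eq_sym.
  - by move=> j ji; rewrite arrPE tpermD // (inj_eq (@arr_inj _ _ s')) eq_sym.
  - by apply: contraNneq ui => <-; rewrite s'l.
  by rewrite /c f_eq pi_eq.
apply: (@arr_cell_conn _ _ _ c l s.[l]) => // {t st_l} s' u v s'l u_in uv us vs.
have [v_in | v_new] := boolP (v \in codom (tnth (val s'))); last exact: new_step.
have [z z_new] := new_ex s'.
have z_ne a : a \in codom (tnth (val s')) -> z != a by apply: contraTneq => <-.
have zu := z_ne _ u_in; have zv := z_ne _ v_in.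
have uz : u != z by rewrite eq_sym.
have vz : v != z by rewrite eq_sym.
have vu : v != u by rewrite eq_sym.
have sz : z != s.[l] by rewrite -s'l z_ne ?codom_f.
pose s1 := arrP k (tperm u z) s'; pose s2 := arrP k (tperm v u) s1.
have -> : arrP k (tperm u v) s' = arrP k (tperm z v) s2.
  apply: arr_ext => j; rewrite !arrPE.
  have jz : z != s'.[j] by rewrite z_ne ?codom_f.
  case: (tpermP u v) => [-> | -> | /eqP ju /eqP jv].
  - by rewrite tpermL (tpermD vz uz) tpermL.
  - by rewrite (tpermD uv zv) tpermL (tpermD zu vu).
  by rewrite !tpermD // eq_sym.
have s1l : s1.[l] = s.[l] by rewrite arrPE s'l tpermD.
have s2l : s2.[l] = s.[l] by rewrite arrPE s1l tpermD.
have u_s1 : u \notin codom (tnth (val s1)).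
  by rewrite -[X in X \notin _](tpermR u z) codom_arrP.
have v_s1 : v \in codom (tnth (val s1)).
  by rewrite -[X in X \in _](tpermD uv zv) codom_arrP.
have z_s1 : z \in codom (tnth (val s1)).
  by rewrite -[X in X \in _](tpermL u z) codom_arrP.
rewrite new_step //; last 2 first.
- by rewrite -[X in X \in _](tpermD vz uz) codom_arrP.
- by rewrite -[X in X \notin _](tpermR v u) codom_arrP.
by rewrite new_step // new_step.
Qed.

End FullAutomorphism.

(** * The derangement graph *)

Section CommonDerangements.

Variable T : finType.
Implicit Types (g h u v : {perm T}) (a b c d p : T).

Definition deranging h := moved h == setT.

(** In the Cayley graph of the derangements, these are the common neighbours of [1] and [g]. *)
Definition avoiding g := [set h | deranging h && [forall x, h x != g x]].

Lemma derangingJ h u : deranging (h ^ u) = deranging h.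
Proof.
apply/eqP/eqP => mh; apply/setP => x; rewrite in_setT in_moved.
  have := in_setT (u x); rewrite -mh in_moved permJ.
  by rewrite (inj_eq perm_inj).
have := in_setT (u^-1 x); rewrite -mh in_moved -[in X in _ -> X](permKV u x) permJ.
by rewrite (inj_eq perm_inj).
Qed.

Definition sending a b := [set h | deranging h && (h a == b)].

Lemma card_conj_le (A B : {set {perm T}}) u :
  (forall h, h \in A -> h ^ u \in B) -> #|A| <= #|B|.
Proof.
move=> AB; rewrite -(card_imset _ (@conjg_inj _ u)).
by apply/subset_leq_card/subsetP => _ /imsetP[h hA ->]; apply: AB.
Qed.

Lemma perm2_ex a b c d : a != b -> c != d -> exists2 u : {perm T}, u a = c & u b = d.
Proof.
move=> ab cd; exists (tperm a c * tperm (tperm a c b) d); rewrite permM ?tpermL //.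
by rewrite tpermD // 1?eq_sym // -{1}(tpermL a c) (inj_eq perm_inj).
Qed.

(** Conjugation by a permutation carrying [a], [b] to [c], [d] preserves derangements, so the
    cardinals bound each other. *)
Lemma card_swapping a b c d : a != b -> c != d ->
  #|sending a b :|: sending b a| = #|sending c d :|: sending d c|.
Proof.
have le w x y z : w != x -> y != z ->
    #|sending w x :|: sending x w| <= #|sending y z :|: sending z y|.
  move=> wx yz; have [u <- <-] := perm2_ex wx yz.
  apply: (@card_conj_le _ _ u) => h; rewrite !inE derangingJ !permJ.
  by rewrite !(inj_eq perm_inj).
by move=> ab cd; apply/eqP; rewrite eqn_leq !le.
Qed.

Lemma card_sending a b c d : a != b -> c != d -> #|sending a b| = #|sending c d|.
Proof.
have le w x y z : w != x -> y != z -> #|sending w x| <= #|sending y z|.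
  move=> wx yz; have [u <- <-] := perm2_ex wx yz.
  apply: (@card_conj_le _ _ u) => h; rewrite !inE derangingJ !permJ.
  by rewrite !(inj_eq perm_inj).
by move=> ab cd; apply/eqP; rewrite eqn_leq !le.
Qed.

(** The complement of [[set a; b]] contains two points, so it is the support of a permutation, to be
    multiplied by [tperm a b]. *)
Lemma swap_deranging_ex a b c d : a != b -> c != d ->
    c \notin [set a; b] -> d \notin [set a; b] ->
  exists h, [/\ deranging h, h a = b, h b = a
    & forall x, x \notin [set a; b] -> h x \notin [set a; b]].
Proof.
move=> ab cd cab dab; have [|u mu] := @derangement_ex _ (~: [set a; b]).
  rewrite (cardsD1 c) inE cab (cardsD1 d) !inE [d == c]eq_sym cd /=.
  by rewrite !inE in dab; rewrite dab.
have fixed x : x \in [set a; b] -> u x = x.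
  by move=> xab; apply/eqP/negbNE; rewrite -in_moved mu inE negbK.
have ua := fixed a (set21 a b); have ub := fixed b (set22 a b).
exists (u * tperm a b); split.
- by rewrite /deranging -[tperm a b]tpermC moved_insert // mu setUCr.
- by rewrite permM ua tpermL.
- by rewrite permM ub tpermR.
move=> x xab; have uxab : u x \notin [set a; b].
  apply: contra xab => uxab; have := fixed _ uxab.
  by move/perm_inj=> ux; rewrite ux in uxab.
by rewrite permM tpermD //; apply: contraNneq uxab => <-; rewrite ?set21 ?set22.
Qed.

(** [h] is the 3-cycle [a], [c], [d] beside a permutation moving all remaining points, which exists
    because [b] and [p] are among them. *)
Lemma deranging_other_ex a b c d p : a != b -> c != d ->
    c \notin [set a; b] -> d \notin [set a; b] ->
    p != a -> p != b -> p != c -> p != d ->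
  exists h, [/\ deranging h, h c = d, h a != b & h b != a].
Proof.
move=> ab cd; rewrite !inE !negb_or => /andP[ca cb] /andP[da db] pa pb pc pd.
have [|u mu] := @derangement_ex _ (~: [set a; c; d]).
  rewrite (cardsD1 b) !inE !negb_or ![b == _]eq_sym ab cb db.
  by rewrite (cardsD1 p) !inE !negb_or pa pb pc pd.
have fixed x : x \in [set a; c; d] -> u x = x.
  by move=> xab; apply/eqP/negbNE; rewrite -in_moved mu inE negbK.
have ua : u a = a by rewrite fixed // !inE eqxx.
have uc : u c = c by rewrite fixed // !inE eqxx orbT.
have ud : u d = d by rewrite fixed // !inE eqxx !orbT.
have va : (u * tperm d c) a = a by rewrite permM ua tpermD.
exists (u * tperm d c * tperm c a); split.
- rewrite /deranging moved_insert 1?eq_sym // moved_insert // mu.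
  apply/eqP/setP => x; rewrite !inE.
  by case: (x == a); case: (x == c); case: (x == d).
- by rewrite !permM uc tpermR tpermD // eq_sym.
- by rewrite permM va tpermR.
rewrite permM -[X in _ != X](tpermL c a) (inj_eq perm_inj).
rewrite permM -[X in _ != X](tpermL d c) (inj_eq perm_inj).
by rewrite -ud (inj_eq perm_inj) eq_sym.
Qed.

(** * Derangements agreeing with a chain [a], [b], [c], [d] *)

Section Chains.

Variables a b c d : T.
Hypotheses (ab : a != b) (ac : a != c) (bc : b != c) (cd : c != d) (bd : b != d).

Let X := sending a b :&: sending b c.
Let Y := sending c d :\: (sending a b :|: sending b c).
Let Z := sending a b :&: sending b a.

(** All the sets [sending x y] with [x != y] have one size, so by inclusion and exclusion the claim
    compares only the overlaps [X], [Z] and the new part [Y]. *)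
Lemma chain_count : #|X| < (#|Y| + #|Z|)%N ->
  #|sending a b :|: sending b a| < #|sending a b :|: sending b c :|: sending c d|.
Proof.
move=> lt_X; set E := sending a b :|: sending b c.
have -> : #|E :|: sending c d| = (#|E| + #|Y|)%N.
  by rewrite -(cardsID E) setUK setDUl setDv set0U.
rewrite -(ltn_add2r #|Z|) cardsUI (@card_sending b a b c) // 1?eq_sym //.
by rewrite -cardsUI -addnA ltn_add2l.
Qed.

Lemma sendingJ u x y h : (h ^ u \in sending (u x) (u y)) = (h \in sending x y).
Proof. by rewrite !inE derangingJ permJ (inj_eq perm_inj). Qed.

(* Conjugation by the cycle (b c d) embeds X into Y. *)
Lemma open_chain : a != d ->
  #|sending a b :|: sending b a| < #|sending a b :|: sending b c :|: sending c d|.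
Proof.
move=> ad; apply: chain_count; apply: leq_trans (_ : #|Y|.+1 <= _).
  pose u := tperm b c * tperm b d.
  have ua : u a = a by rewrite permM !tpermD // eq_sym.
  have ub : u b = c by rewrite permM tpermL tpermD // eq_sym.
  have uc : u c = d by rewrite permM tpermR tpermL.
  have ud : u d = b by rewrite permM (tpermD bd cd) tpermR.
  rewrite ltnS; apply: (@card_conj_le _ _ u) => h; rewrite in_setI => /andP[hab hbc].
  have hE x : (h ^ u) (u x) = u (h x) by apply: permJ.
  have /andP[mh /eqP ha] : deranging h && (h a == b) by rewrite inE in hab.
  have hua : (h ^ u) a = c by rewrite -{1}ua hE ha.
  have hub : (h ^ u) b != c.
    by rewrite -{1}ud hE -ub (inj_eq perm_inj) -ha (inj_eq perm_inj) eq_sym.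
  rewrite !inE derangingJ mh hua [c == b]eq_sym (negPf bc) (negPf hub) /=.
  by move: hbc; rewrite -(sendingJ u) ub uc inE => /andP[].
(* Strictness comes from [Z] being nonempty. *)
rewrite -[X in X <= _]addn1 leq_add2l card_gt0; apply/set0Pn.
have cab : c \notin [set a; b] by rewrite !inE negb_or ![c == _]eq_sym ac.
have dab : d \notin [set a; b] by rewrite !inE negb_or ![d == _]eq_sym ad.
have [h [mh ha hb _]] := swap_deranging_ex ab cd cab dab.
by exists h; rewrite !inE mh ha hb !eqxx.
Qed.

(* With X split according to [h c == p], conjugation by the cycle (b c a p) embeds
   one part into Y, missing the permutations which swap a and c; splicing embeds
   the other one into Z. *)
Lemma closed_chain p : d = a -> p != a -> p != b -> p != c ->
  #|sending a b :|: sending b a| < #|sending a b :|: sending b c :|: sending c d|.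
Proof.
move=> da pa pb pc; apply: chain_count.
rewrite -(cardsID (sending c p)) addnC -addSn; apply: leq_add.
  pose u := tperm b c * tperm b a * tperm b p.
  have [ba cb ca] : [/\ b != a, c != b & c != a] by split; rewrite eq_sym.
  have [ap bp cp] : [/\ a != p, b != p & c != p] by split; rewrite eq_sym.
  have ub : u b = c by rewrite !permM tpermL (tpermD bc ac) (tpermD bc pc).
  have uc : u c = a by rewrite !permM tpermR tpermL (tpermD ba pa).
  have ua : u a = p by rewrite !permM (tpermD ba ca) tpermR tpermL.
  have up : u p = b by rewrite !permM (tpermD bp cp) (tpermD bp ap) tpermR.
  have bca : b \notin [set c; a] by rewrite !inE negb_or bc eq_sym.
  have pca : p \notin [set c; a] by rewrite !inE negb_or pc.
  have [y [my yc ya y_out]] := swap_deranging_ex ca bp bca pca.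
  have yY : y \in Y.
    rewrite !inE my yc ya da eqxx [c == b]eq_sym (negPf bc) /= andbT.
    by apply: contra (y_out b bca) => /eqP->; rewrite set21.
  rewrite (cardsD1 y Y) yY ltnS; apply: (@card_conj_le _ _ u) => h.
  rewrite !in_setD in_setI => /andP[hcp /andP[hab hbc]].
  have hE x : (h ^ u) (u x) = u (h x) by apply: permJ.
  have /andP[mh /eqP ha] : deranging h && (h a == b) by rewrite inE in hab.
  rewrite inE mh in hcp.
  have hua : (h ^ u) a != b by rewrite -{1}uc hE -up (inj_eq perm_inj).
  have hub : (h ^ u) b != c.
    by rewrite -{1}up hE -ub (inj_eq perm_inj) -ha (inj_eq perm_inj).
  have huc : (h ^ u) c == a.
    by move: hbc; rewrite -(sendingJ u) ub uc inE => /andP[].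
  rewrite !inE derangingJ mh (negPf hua) (negPf hub) da huc !andbT.
  apply: contraNneq (y_out p pca) => <-.
  by rewrite -{1}ua hE ha ub set21.
(* [f h] exchanges the images of [b] and [w = h^-1 a], so [b] goes to [a] and [w] to [c]. Thus [w],
   and then [h], is recovered from [f h]; and [h c = p] excludes [w = c], which would become a fixed
   point. *)
pose f h := tperm b (h^-1 a) * h; pose D := X :&: sending c p.
have fD h : h \in D -> [/\ deranging h, h a = b, h b = c & h c = p].
  by rewrite !inE => /andP[/andP[/andP[-> /eqP->] /andP[_ /eqP->]] /andP[_ /eqP->]].
have fw h : h \in D -> (f h)^-1 c = h^-1 a.
  by move/fD=> [_ _ hb _]; apply: (@perm_inj _ (f h)); rewrite permKV permM tpermR.
rewrite -(@card_in_imset _ _ f D) => [|h1 h2 hD1 hD2 eq_f]; last first.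
  apply: (@mulgI _ (tperm b (h1^-1 a))); rewrite -/(f h1) eq_f.
  by rewrite -(fw _ hD1) eq_f (fw _ hD2).
apply/subset_leq_card/subsetP => y /imsetP[h hD ->] {y}.
have [mh ha hb hc] := fD h hD; set w := h^-1 a.
have hw : h w = a by rewrite permKV.
have wa : w != a by apply: contraNneq ab => e; rewrite -ha -{1}hw e.
have wc : w != c by apply: contraNneq pa => e; rewrite -hc -e hw.
have fb : f h b = a by rewrite permM tpermL.
have fa : f h a = b by rewrite permM tpermD // eq_sym.
suff mf : deranging (f h) by rewrite !inE mf fa fb !eqxx.
apply/eqP/setP => x; rewrite in_setT in_moved permM.
case: tpermP => [-> | -> | _ _]; first by rewrite hw.
  by rewrite hb eq_sym.
by rewrite -in_moved (eqP mh) in_setT.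
Qed.

End Chains.
(** Let [b = g a]. If [g] swaps [a] and [b], it moves a further point [c], and some derangement
    agrees with [g] at [c] but not at [a] or [b]. Otherwise [a], [b], [g b], [g (g b)] is a chain,
    open or closed up at [a]. The fixed point [p] is the spare point in the first and the closed
    case. *)
Lemma hitting_transp g p a : g p = p -> g a != a -> ~~ transp g ->
  #|sending a (g a) :|: sending (g a) a|
    < #|[set h | deranging h && [exists x, h x == g x]]|.
Proof.
move=> gp ga not_transp; set b := g a; set W := [set h | _].
have sub x : sending x (g x) \subset W.
  apply/subsetP => h; rewrite !inE => /andP[-> hx] /=.
  by apply/existsP; exists x.
have ne_p x : g x != x -> p != x by apply: contraNneq => <-; rewrite gp.
have ab : a != b by rewrite eq_sym.
have pa := ne_p _ ga; have pb : p != b by rewrite -gp (inj_eq perm_inj).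
have [gb | gb] := eqVneq (g b) a.
  have [c /andP[c_ab gc]] : exists c, (c \notin [set a; b]) && (g c != c).
    apply/existsP; apply: contraR not_transp => /existsPn all_fixed.
    apply/transpP; exists a, b; split=> //; apply/permP => x.
    case: tpermP => [-> // | -> // | /eqP xa /eqP xb].
    by have := all_fixed x; rewrite !inE negb_or xa xb negbK => /eqP.
  move: (c_ab); rewrite !inE negb_or => /andP[ca cb].
  have dab : g c \notin [set a; b].
    by rewrite !inE negb_or -{1}gb !(inj_eq perm_inj) cb.
  have cgc : c != g c by rewrite eq_sym.
  have pc := ne_p _ gc; have pgc : p != g c by rewrite -{1}gp (inj_eq perm_inj).
  have [h [mh hc ha hb]] := deranging_other_ex ab cgc c_ab dab pa pb pc pgc.
  apply/proper_card/properP; split; first by rewrite subUset -{2}gb !sub.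
  exists h; last by rewrite !inE negb_or !negb_and ha hb !orbT.
  by rewrite inE mh; apply/existsP; exists c; rewrite hc.
have ac : a != g b by rewrite eq_sym.
have bc : b != g b by rewrite (inj_eq perm_inj).
have cd : g b != g (g b) by rewrite (inj_eq perm_inj).
have bd : b != g (g b) by rewrite (inj_eq perm_inj).
apply: (@leq_trans #|sending a b :|: sending b (g b) :|: sending (g b) (g (g b))|).
  have [da | ad] := eqVneq (g (g b)) a; last first.
    by apply: open_chain => //; rewrite eq_sym.
  apply: (closed_chain ab ac bc da pa pb).
  by rewrite -gp (inj_eq perm_inj).
by apply/subset_leq_card; rewrite !subUset !sub.
Qed.

Lemma hitting_tperm a b : a != b ->
  [set h | deranging h && [exists x, h x == tperm a b x]] = sending a b :|: sending b a.
Proof.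
move=> ab; apply/setP => h; rewrite !inE -andb_orr.
have [/eqP mh /= | //] := boolP (deranging h); apply/existsP/orP => [[x] | [] hx].
- case: tpermP => [-> | -> | _ _] => [|| hx]; [by left | by right |].
  by have := in_setT x; rewrite -mh in_moved hx.
- by exists a; rewrite tpermL.
by exists b; rewrite tpermR.
Qed.

Lemma avoiding_count g :
  (#|avoiding g| + #|[set h | deranging h && [exists x, h x == g x]]|)%N
    = #|[set h | deranging h]|.
Proof.
rewrite -[RHS](cardsID (avoiding g)); congr (_ + _)%N; apply: eq_card => h.
  by rewrite !inE; case: deranging.
rewrite !inE.
rewrite negb_and negb_forall; case: deranging => //=; rewrite andbT.
by apply: eq_existsb => x; rewrite negbK.
Qed.

(** A non-derangement [g] has a fixed point. The derangements agreeing somewhere with [g] are as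
    many as for [u] if [g] is a transposition, and more otherwise; [avoiding g] is their
    complement. *)
Lemma avoiding_max u g : transp u -> ~~ deranging g -> g != 1 ->
  #|avoiding g| <= #|avoiding u| ?= iff transp g.
Proof.
move=> /transpP[a [b [ab ->]]] g_fix g1.
have /existsP[p /eqP gp] : [exists p, g p == p].
  apply: contraR g_fix => /existsPn g_moved.
  by apply/eqP/setP => x; rewrite in_setT in_moved g_moved.
have [x gx] : exists x, g x != x.
  by rewrite -moved_eq0 in g1; have [x] := set0Pn _ g1; rewrite in_moved; exists x.
have := avoiding_count g; rewrite -(avoiding_count (tperm a b)) hitting_tperm //.
have [/transpP[c [d [cd ->]]] | not_transp] := boolP (transp g).
  by rewrite hitting_tperm // (card_swapping ab cd) => /addIn->; apply/leqif_refl.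
move=> eq_card; apply/leqifP.
have xgx : x != g x by rewrite eq_sym.
have := hitting_transp gp gx not_transp; rewrite (card_swapping xgx ab).
by rewrite -(ltn_add2l #|avoiding (tperm a b)|) -eq_card ltn_add2r.
Qed.

End CommonDerangements.

(** * Automorphisms for [r = k = n] *)

Section DerangementGraph.

Variable n : nat.
Hypothesis n_gt2 : 2 < n.
Implicit Types (s t x : arrangement n n) (u g h : 'S_n).

Lemma arr_adj_avoid s g h :
  arr_adj n (arrQ n g s) (arrQ n h s) = [forall i, h i != g i].
Proof.
apply/arr_adj_fullP/forallP => [ne i | ne i].
  apply/negP => /eqP hg; have := ne (h i).
  by rewrite !arrQE permK {1}hg permK eqxx.
rewrite !arrQE (inj_eq (@arr_inj _ _ s)); apply/negP => /eqP gh.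
by have := ne (h^-1 i); rewrite -{2}gh !permKV eqxx.
Qed.

Lemma arr_adj_deranging s h : arr_adj n s (arrQ n h s) = deranging h.
Proof.
have := arr_adj_avoid s 1 h; rewrite arrQ1 perm1 => ->.
apply/forallP/eqP => [ne | mh i].
  by apply/setP => i; rewrite in_setT in_moved -[X in _ != X]perm1 ne.
by have := in_setT i; rewrite -mh in_moved perm1.
Qed.

Lemma arr_adj2_transp s h : arr_adj 2 s (arrQ n h s) = transp h.
Proof. by have := arr_adj2E s 1 h; rewrite arrQ1 perm1 invg1 mul1g. Qed.

Lemma common_avoiding s g : common s (arrQ n g s) = #|avoiding g|.
Proof.
rewrite /common -(card_imset _ (fun h1 h2 => @arrQ_free _ s h1 h2)).
apply: eq_card => x; have [h ->] := arrQ_transitive s x.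
rewrite mem_imset => [|h1 h2 /arrQ_free //].
by rewrite !inE arr_adj_deranging arr_adj_avoid.
Qed.

Lemma adj2_not_full s t : arr_adj 2 s t -> ~~ arr_adj n s t.
Proof. by rewrite /arr_adj => /eqP->; rewrite eq_sym gtn_eqF. Qed.

Lemma common_max2 s t x : arr_adj 2 s t -> ~~ arr_adj n s x -> x != s ->
  common s x <= common s t ?= iff arr_adj 2 s x.
Proof.
have [u ->] := arrQ_transitive s t; have [g ->] := arrQ_transitive s x.
rewrite !arr_adj2_transp arr_adj_deranging !common_avoiding => tu g_fix gs.
apply: avoiding_max => //; apply: contraNneq gs => ->.
by rewrite arrQ1 perm1.
Qed.

(** Differing by a transposition means attaining the maximum of [common s] over the nonadjacent
    vertices other than [s], and [f] preserves both notions. The preimage of the maximiser [x]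
    supplies the reverse inequality. *)
Lemma derangement_adj2 (f : {perm arrangement n n}) s t :
  f \in graph_aut (@arr_adj n n n) -> arr_adj 2 s t -> arr_adj 2 (f s) (f t).
Proof.
move=> f_aut st; have fE := graph_autP _ _ f_aut.
pose i0 := Ordinal (ltnW (ltnW n_gt2)); pose i1 := Ordinal (ltnW n_gt2).
pose x := arrQ n (tperm i0 i1) (f s).
have fsx : arr_adj 2 (f s) x by rewrite arr_adj2_transp transp_tperm.
have ft : ~~ arr_adj n (f s) (f t) by rewrite fE adj2_not_full.
have ts : f t != f s.
  by rewrite (inj_eq perm_inj); apply: contraTneq st => ->; rewrite arr_adj_irr.
have xs : f^-1 x != s.
  by apply: contraTneq fsx => <-; rewrite permKV arr_adj_irr.
have sx : ~~ arr_adj n s (f^-1 x) by rewrite -fE permKV adj2_not_full.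
rewrite -(common_max2 fsx ft ts).2 eqn_leq (common_max2 fsx ft ts).1 /=.
rewrite -[x](permKV f) !common_aut //; exact: (common_max2 st sx xs).1.
Qed.

Lemma derangement_aut_adj2 :
  graph_aut (@arr_adj n n n) \subset graph_aut (@arr_adj n n 2).
Proof.
apply/subsetP => f f_aut; apply/graph_autP => s t; apply/idP/idP.
  by move/(derangement_adj2 (groupVr f_aut)); rewrite !permK.
exact: derangement_adj2.
Qed.

Lemma arrPQV_aut r :
  (arrP_Sym n n * arrQ_Sym n n) * <[arrV n]> \subset graph_aut (@arr_adj n n r).
Proof. by rewrite mul_subG ?arrPQ_aut // cycle_subG arrV_aut. Qed.

Lemma aut_adj2E :
  graph_aut (@arr_adj n n 2) = (arrP_Sym n n * arrQ_Sym n n) * <[arrV n]>.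
Proof.
apply/eqP; rewrite eqEsubset arrPQV_aut andbT; apply/subsetP => f.
exact: transposition_aut.
Qed.

Lemma aut_adj_fullE :
  graph_aut (@arr_adj n n n) = (arrP_Sym n n * arrQ_Sym n n) * <[arrV n]>.
Proof.
apply/eqP; rewrite eqEsubset arrPQV_aut andbT -aut_adj2E.
exact: derangement_aut_adj2.
Qed.

End DerangementGraph.

(** * The three cases of the classification *)

Theorem theorem1p2 (n k r : nat)
    (n_gt2 : 2 < n) (r_ge1 : 1 <= r) (le_rk : r <= k) (le_kn : k <= n) :
  [/\ (r = k -> k < n ->
        exists G : {group {perm arrangement n k}},
          arrP_Sym n k \x arrQ_Sym n k = G
          /\ graph_aut (@arr_adj n k r) \isog G),
      (r = k -> k = n ->
        exists G : {group {perm arrangement n n}},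
          [/\ #[arrV n] = 2,
              (arrP_Sym n n \x arrQ_Sym n n) ><| <[arrV n]> = G
            & graph_aut (@arr_adj n n r) \isog G])
    & (r = 2 -> k = n ->
        exists G : {group {perm arrangement n n}},
          [/\ #[arrV n] = 2,
              (arrP_Sym n n \x arrQ_Sym n n) ><| <[arrV n]> = G
            & graph_aut (@arr_adj n n r) \isog G])].
Proof.
split=> [rk lt_kn | rk kn | r2 _].
- move: r_ge1; rewrite rk => k_gt0.
  (* The automorphism group is equal to the product, so it serves as [G] itself. *)
  exists (graph_aut_group (@arr_adj n k k)); split; last exact: isog_refl.
  rewrite (arrPQ_dprod n_gt2 le_kn); apply/eqP.
  by rewrite eqEsubset arrPQ_aut (full_aut lt_kn k_gt0 n_gt2).
- rewrite rk kn; exists (graph_aut_group (@arr_adj n n n)).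
  by rewrite (arrV_order n_gt2) (arrPQV_sdprod n_gt2) -(aut_adj_fullE n_gt2) isog_refl.
- rewrite r2; exists (graph_aut_group (@arr_adj n n 2)).
  by rewrite (arrV_order n_gt2) (arrPQV_sdprod n_gt2) -(aut_adj2E n_gt2) isog_refl.
Qed.
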